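(* Let $J\subseteq I$ and $\nu_1,\dots,\nu_m\in\Lambda_J^\vee$. For each $k\in\{1,\dots,m\}$ let $W_k$ be a highest $\ell$-weight $U_q^{\nu_k}(\mathfrak g_J)$-module and let $V_k$ be a $J$-inflation of $W_k$ to $\mathfrak g$. Then $V_1\star\cdots\star V_m$ is a $J$-inflation of $W_1\star\cdots\star W_m$ to $\mathfrak g$.
   Context: Setup. Everything is over $\mathbb C$; $\mathbb N=\mathbb Z_{\ge 0}$. $\mathfrak g$ is a finite-dimensional simple Lie algebra with Dynkin index set $I=\{1,\dots,n\}$ and Cartan matrix $C=(C_{i,j})_{i,j\in I}$; $d_1,\dots,d_n$ are the relatively prime positive integers such that $(d_iC_{i,j})$ is symmetric. $\alpha_i,\omega_i,\omega_i^\vee$ are the simple roots, fundamental weights and fundamental coweights (so $\alpha_i(\omega_j^\vee)=\delta_{i,j}$ and $\alpha_i=\sum_jC_{j,i}\omega_j$), and $\Lambda^\vee=\bigoplus_{i\in I}\mathbb Z\omega_i^\vee$. $q\in\mathbb C^\times$ is not a root of unity and $q_i=q^{d_i}$. For $J\subseteq I$, $\mathfrak g_J$ is the semisimple Lie algebra with Cartan matrix $(C_{i,j})_{i,j\in J}$, $Q_J^+=\bigoplus_{j\in J}\mathbb N\alpha_j$, $\Lambda_J^\vee=\bigoplus_{j\in J}\mathbb Z\omega_j^\vee\subseteq\Lambda^\vee$, and $\mathrm{res}_J:\Lambda^\vee\to\Lambda_J^\vee$ is the projection. Algebras. For $J\subseteq I$ and $\nu\in\Lambda_J^\vee$, $U_q^\nu(\mathfrak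 g_J)$ is the unital algebra generated by $x_{i,r}^\pm,\phi_{i,r}^\pm$ ($i\in J$, $r\in\mathbb Z$), with $\phi_{i,0}^+$ and $\phi^-_{i,\alpha_i(\nu)}$ invertible, and relations (for $i,j\in J$, $r,s\in\mathbb Z$, $m\in\mathbb Z\setminus\{0\}$): all the $\phi^{\pm}_{i,r}$ commute with each other; $\phi_{i,0}^+x_{j,r}^\pm=q_i^{\pm C_{i,j}}x_{j,r}^\pm\phi_{i,0}^+$; $\phi_{i,\alpha_i(\nu)}^-x_{j,r}^\pm=q_i^{\mp C_{i,j}}x_{j,r}^\pm\phi_{i,\alpha_i(\nu)}^-$; $[h_{i,m},x_{j,r}^\pm]=\pm\frac1m[mC_{i,j}]_{q_i}x_{j,m+r}^\pm$; $(q_i-q_i^{-1})[x_{i,r}^+,x_{j,s}^-]=\delta_{i,j}(\phi_{i,r+s}^+-\phi_{j,r+s}^-)$; $x_{i,r+1}^\pm x_{j,s}^\pm-q_i^{\pm C_{i,j}}x_{j,s}^\pm x_{i,r+1}^\pm=q_i^{\pm C_{i,j}}x_{i,r}^\pm x_{j,s+1}^\pm-x_{j,s+1}^\pm x_{i,r}^\pm$; and, for $i\ne j$, $p=1-C_{i,j}$ and $r',r_1,\dots,r_p\in\mathbb Z$, $\sum_{\pi\in\Sigma_p}\sum_{\ell=0}^p(-1)^\ell\frac{[p]_{q_i}!}{[\ell]_{q_i}![p-\ell]_{q_i}!}x^\pm_{i,r_{\pi(1)}}\cdots x^\pm_{i,r_{\pi(\ell)}}x^\pm_{j,r'}x^\pm_{i,r_{\pi(\ell+1)}}\cdots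 x^\pm_{i,r_{\pi(p)}}=0$. Here $[m]_x=\frac{x^m-x^{-m}}{x-x^{-1}}$, $[m]_x!=\prod_{r=1}^m[r]_x$, and the $h_{i,m}$ are defined by $\sum_{r\in\mathbb Z}\phi^\pm_{i,\pm r}z^{\pm r}=z^{\nu(i,\pm)}\phi^\pm_{i,\nu(i,\pm)}\exp\big(\pm(q_i-q_i^{-1})\sum_{m>0}h_{i,\pm m}z^{\pm m}\big)$ with $\nu(i,+)=0$, $\nu(i,-)=\alpha_i(\nu)$ (so $\phi_{i,r}^+=0$ for $r<0$ and $\phi_{i,r}^-=0$ for $r>\alpha_i(\nu)$). Currents: $x_i^\pm(z)=\sum_{r}x_{i,r}^\pm z^r$, $\phi_i^\pm(z)=\sum_r\phi_{i,r}^\pm z^r$. For $J=I$ this is the shifted quantum affine algebra $U_q^\mu(\mathfrak g)$, $\mu\in\Lambda^\vee$. If $\mathrm{res}_J(\mu)=\nu$, identifying generators with the same name gives an embedding $U_q^\nu(\mathfrak g_J)\hookrightarrow U_q^\mu(\mathfrak g)$, and $\mathrm{res}_J^\mu$ denotes the corresponding restriction functor. Category $\mathcal O$. Let $\mathfrak t_J^\times=(\mathbb C^\times)^J$, ordered by: $\gamma\le\gamma'$ iff $\gamma'\gamma^{-1}=\big(\prod_{i\in J}q_j^{a_iC_{j,i}}\big)_{j\in J}$ for some $\sum_{i\in J} a_i\alpha_i\in Q_J^+$. For a $U_q^\nu(\mathfrak g_J)$-module $V$ and $\gamma\in\mathfrak t_J^\times$ let $V_\gamma=V_\gamma^+=\{v:\phi_{i,0}^+v=\gamma_iv\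 \forall i\in J\}$, $V_\gamma^-=\{v:\phi_{i,\alpha_i(\nu)}^-v=\gamma_i^{-1}v\ \forall i\in J\}$, $P(V)=\{\gamma:V_\gamma\ne0\}$, $P^-(V)=\{\gamma:V_\gamma^-\neq0\}$. $\mathcal O_J^\nu$ is the full subcategory of $U_q^\nu(\mathfrak g_J)$-modules $V$ with $V=\bigoplus_\gamma V_\gamma=\bigoplus_\gamma V_\gamma^-$, $\dim V_\gamma^\pm<\infty$ for all $\gamma$, and $P(V)\cup P^-(V)\subseteq\bigcup_{i=1}^s\{\gamma:\gamma\le\lambda_i\}$ for some $\lambda_1,\dots,\lambda_s\in\mathfrak t_J^\times$. $\mathcal O^\mu=\mathcal O_I^\mu$. Highest $\ell$-weight modules. A highest $\ell$-weight $U_q^\nu(\mathfrak g_J)$-module is an object of $\mathcal O_J^\nu$ generated by some $v\ne0$ (a highest $\ell$-weight vector) with $x_j^+(z)v=0$ and $\phi_j^\pm(z)v=\Psi_j(z)v$ for all $j\in J$, where $\Psi=(\Psi_j(z))_{j\in J}$ is a tuple of rational functions regular and nonzero at $z=0$ (expanded at $z=0$ for $+$, at $z=\infty$ for $-$). Fusion product. For $\nu_1,\nu_2\in\Lambda_J^\vee$ the Drinfeld coproduct $\Delta^{(u)}_{\nu_1,\nu_2}:U_q^{\nu_1+\nu_2}(\mathfrak g_J)\to(U_q^{\nu_1}(\mathfrak g_J)\otimes U_q^{\nu_2}(\mathfrak g_J))((u))$ is the algebra morphism with $\phi_i^\pm(z)\mapsto\phi_i^\pm(z)\otimes\phi_i^\pm(zu)$,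 $x_i^+(z)\mapsto x_i^+(z)\otimes1+\phi_i^-(z)\otimes x_i^+(zu)$, $x_i^-(z)\mapsto1\otimes x_i^-(zu)+x_i^-(z)\otimes\phi_i^+(zu)$ ($i\in J$). If $V_1,V_2$ are highest $\ell$-weight objects of $\mathcal O_J^{\nu_1},\mathcal O_J^{\nu_2}$ with highest $\ell$-weight vectors $v_1,v_2$, this gives an action of $U_q^{\nu_1+\nu_2}(\mathfrak g_J)$ on $(V_1\otimes V_2)((u))$ preserving the subspace $(V_1\otimes V_2)(u)$ of Laurent series having a rational expression. With $\mathscr A=\{f\in\mathbb C(u): f\text{ regular at }u=1\}$ and $X$ the $(\mathscr A\otimes U_q^{\nu_1+\nu_2}(\mathfrak g_J))$-submodule of $(V_1\otimes V_2)(u)$ generated by $v_1\otimes v_2$, the fusion product is $V_1\star V_2=X/(u-1)X$, a highest $\ell$-weight object of $\mathcal O_J^{\nu_1+\nu_2}$ whose highest $\ell$-weight is the product of those of $V_1$ and $V_2$. Iteratively, $V_1\star\cdots\star V_m=(V_1\star\cdots\star V_{m-1})\star V_m$. For $J=I$ this is the fusion product of modules over the $U_q^\mu(\mathfrak g)$. Inflation. Let $W$ be an object of $\mathcal O_J^\nu$, $\mathrm{res}_J(\mu)=\nu$ and $V$ an object of $\mathcal O^\mu$. $V$ is a $J$-inflation of $W$ to $\mathfrak g$ with coweight $\mu$ if (i) $\mathrm{res}_J^\mu(V)\simeq W$ as $U_q^\nu(\mathfrak g_J)$-modules and (ii) $x_i^\pm(z) V=0$ for all $i\in I\setminus J$.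 ($J$-inflations of highest $\ell$-weight modules are highest $\ell$-weight modules.) *)

(* Defs.v *)
From HB Require Import structures.
From mathcomp Require Import all_boot all_order all_algebra perm.
From mathcomp Require Import fraction generic_quotient.
From mathcomp Require Import boolp classical_sets fsbigop.

Set Implicit Arguments.
Unset Strict Implicit.
Unset Printing Implicit Defensive.

Import Order.TTheory GRing.Theory Num.Theory.
Local Open Scope ring_scope.
Local Open Scope quotient_scope.

(* A finite-dimensional simple complex Lie algebra enters only through its     *)
(* Cartan matrix: an indecomposable Cartan matrix of finite type, here with    *)
(* its relatively prime symmetrizing integers d.                               *)
Record simple_cartan (n : nat) (C : 'M[int]_n) (d : 'I_n -> nat) : Prop := {
  rank_gt0 : (0 < n)%N;
  cartan_diag : forall i, C i i = 2;
  cartan_offdiag : forall i j, i != j -> C i j <= 0;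
  cartan_zero : forall i j, (C i j == 0) = (C j i == 0);
  cartan_d_gt0 : forall i, (0 < d i)%N;
  cartan_d_gcd : \big[gcdn/0%N]_i d i = 1%N;
  cartan_sym : forall i j, (d i)%:Z * C i j = (d j)%:Z * C j i;
  cartan_posdef : forall a : 'I_n -> rat, (exists i, a i != 0) ->
    0 < \sum_i \sum_j a i * ((d i)%:Z * C i j)%:~R * a j;
  cartan_indec : forall A : {set 'I_n}, A != finset.set0 -> A != [set: 'I_n]%SET ->
    exists i j, [/\ i \in A, j \notin A & C i j != 0]
}.

Section Tensor.
Variables (K : fieldType) (V1 V2 : lmodType K).

Definition bilinear_map (M : lmodType K) (b : V1 -> V2 -> M) : Prop :=
  (forall w, linear (b^~ w)) /\ (forall v, linear (b v)).

(* V1 (x) V2 is the set of formal sums of pairs (v, w), two of them being      *)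
(* identified when no bilinear map distinguishes them.                         *)
Definition tensor_eval (M : lmodType K) (b : V1 -> V2 -> M)
  (s : seq (V1 * V2)) : M := \sum_(p <- s) b p.1 p.2.

Definition tensor_eqv : rel (seq (V1 * V2)) := fun s t =>
  `[< forall (M : lmodType K) (b : V1 -> V2 -> M), bilinear_map b ->
      tensor_eval b s = tensor_eval b t >].

Fact tensor_eqv_refl : reflexive tensor_eqv.
Proof. by move=> s; apply/asboolP. Qed.

Fact tensor_eqv_sym : symmetric tensor_eqv.
Proof.
by move=> s t; apply/asboolP/asboolP => h M b hb; rewrite h.
Qed.

Fact tensor_eqv_trans : transitive tensor_eqv.
Proof.
move=> t s r /asboolP h1 /asboolP h2; apply/asboolP => M b hb.
by rewrite h1 // h2.
Qed.

Canonical tensor_equiv :=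
  EquivRel tensor_eqv tensor_eqv_refl tensor_eqv_sym tensor_eqv_trans.

Definition tensor : Type := {eq_quot tensor_equiv}.

HB.instance Definition _ : EqQuotient _ tensor_equiv tensor :=
  EqQuotient.on tensor.
HB.instance Definition _ := Choice.on tensor.

Fact tensor_pi_eq (s t : seq (V1 * V2)) :
  (forall (M : lmodType K) (b : V1 -> V2 -> M), bilinear_map b ->
     tensor_eval b s = tensor_eval b t) -> \pi_tensor s = \pi_tensor t.
Proof. by move=> h; apply/eqmodP; apply/asboolP. Qed.

Fact tensor_repr_eval (M : lmodType K) (b : V1 -> V2 -> M) (s : seq (V1 * V2)) :
  bilinear_map b -> tensor_eval b (repr (\pi_tensor s)) = tensor_eval b s.
Proof.
have /eqmodP/asboolP h : \pi_tensor (repr (\pi_tensor s)) = \pi_tensor s.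
  by rewrite reprK.
by apply: h.
Qed.

Definition pure (v : V1) (w : V2) : tensor := \pi_tensor [:: (v, w)].
Definition tensor_zero : tensor := \pi_tensor [::].
Definition tensor_add (x y : tensor) : tensor := \pi_tensor (repr x ++ repr y).
Definition tensor_scale (a : K) (x : tensor) : tensor :=
  \pi_tensor [seq (a *: p.1, p.2) | p <- repr x].
Definition tensor_opp (x : tensor) : tensor := tensor_scale (-1) x.

Fact tensor_eval_cat (M : lmodType K) (b : V1 -> V2 -> M) s t :
  tensor_eval b (s ++ t) = tensor_eval b s + tensor_eval b t.
Proof. by rewrite /tensor_eval big_cat. Qed.

Fact tensor_eval_scale (M : lmodType K) (b : V1 -> V2 -> M) a s :
  bilinear_map b ->
  tensor_eval b [seq (a *: p.1, p.2) | p <- s] = a *: tensor_eval b s.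
Proof.
move=> [hb _]; rewrite /tensor_eval big_map scaler_sumr.
apply: eq_bigr => p _ /=; have h := hb p.2.
have h0 : b 0 p.2 = 0.
  by have := h (-1) 0 0; rewrite /= scaler0 addr0 scaleN1r addNr.
by have := h a p.1 0; rewrite /= !addr0 h0 addr0.
Qed.

Let evalE := (tensor_eval_cat, tensor_repr_eval, tensor_eval_scale).

Fact tensor_addA : associative tensor_add.
Proof.
by move=> x y z; apply: tensor_pi_eq => M b hb; rewrite !evalE // addrA.
Qed.

Fact tensor_addC : commutative tensor_add.
Proof.
by move=> x y; apply: tensor_pi_eq => M b hb; rewrite !evalE // addrC.
Qed.

Fact tensor_add0 : left_id tensor_zero tensor_add.
Proof.
move=> x; rewrite -[RHS]reprK; apply: tensor_pi_eq => M b hb.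
by rewrite !evalE // /tensor_eval big_nil add0r.
Qed.

Fact tensor_addN : left_inverse tensor_zero tensor_opp tensor_add.
Proof.
move=> x; apply: tensor_pi_eq => M b hb.
by rewrite !evalE // scaleN1r addNr /tensor_eval big_nil.
Qed.

HB.instance Definition _ :=
  GRing.isZmodule.Build tensor tensor_addA tensor_addC tensor_add0 tensor_addN.

Fact tensor_scaleA a b x :
  tensor_scale a (tensor_scale b x) = tensor_scale (a * b) x.
Proof.
by apply: tensor_pi_eq => M c hc; rewrite !evalE // scalerA.
Qed.

Fact tensor_scale1 : left_id 1 tensor_scale.
Proof.
move=> x; rewrite -[RHS]reprK; apply: tensor_pi_eq => M b hb.
by rewrite !evalE // scale1r.
Qed.

Fact tensor_scaleDr : right_distributive tensor_scale +%R.
Proof.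
by move=> a x y; apply: tensor_pi_eq => M b hb; rewrite !evalE // scalerDr.
Qed.

Fact tensor_scaleDl x : {morph tensor_scale^~ x : a b / a + b >-> a + b}.
Proof.
by move=> a c; apply: tensor_pi_eq => M b hb; rewrite !evalE // scalerDl.
Qed.

HB.instance Definition _ := GRing.Zmodule_isLmodule.Build K tensor
  tensor_scaleA tensor_scale1 tensor_scaleDr tensor_scaleDl.

Fact pure_bilinear : bilinear_map pure.
Proof.
have h s t : \pi_tensor s + \pi_tensor t = \pi_tensor (s ++ t).
  by apply: tensor_pi_eq => M b hb; rewrite !evalE.
split=> [w|v] a x y; rewrite /pure; apply: tensor_pi_eq => M b hb;
  rewrite !evalE // /tensor_eval !big_seq1 /=.
  exact: hb.1.
exact: hb.2.
Qed.

Fact tensor_sum_pure (x : tensor) : x = \sum_(p <- repr x) pure p.1 p.2.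
Proof.
rewrite -[LHS]reprK; elim: (repr x) => [|p s IHs]; first by rewrite big_nil.
rewrite big_cons -IHs; apply: tensor_pi_eq => M b hb.
by rewrite !evalE // /tensor_eval big_cons big_seq1.
Qed.

Fact tensor_universal (M : lmodType K) (b : V1 -> V2 -> M) : bilinear_map b ->
  exists2 f : {linear tensor -> M}, (forall v w, f (pure v w) = b v w) &
    forall g : {linear tensor -> M},
      (forall v w, g (pure v w) = b v w) -> g =1 f.
Proof.
move=> hb; pose f (x : tensor) := tensor_eval b (repr x).
have lf : linear f by move=> a x y; rewrite /f !evalE.
pose F : {linear tensor -> M} :=
  HB.pack f (GRing.isLinear.Build K tensor M *:%R f lf).
exists F => [v w|g hg x]; first by rewrite /= /f evalE // /tensor_eval big_seq1.
rewrite [in LHS](tensor_sum_pure x) raddf_sum /= /f /tensor_eval.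
by apply: eq_bigr => p _; rewrite hg.
Qed.

(* (f (x) g) for linear endomorphisms f and g *)
Definition tmap (f : V1 -> V1) (g : V2 -> V2) (x : tensor) : tensor :=
  \sum_(p <- repr x) pure (f p.1) (g p.2).

End Tensor.

Section Series.
Variables (K : fieldType) (T : lmodType K).
Implicit Types (f g h : int -> T) (P Q : {poly K}) (F : {fraction {poly K}}).

(* A formal series sum_k f_k u^k, k in Z, is the function f : int -> T. *)

Definition cst_ser (v : T) : int -> T := fun k => if k == 0 then v else 0.

Definition pmul_ser Q f : int -> T :=
  fun k => \sum_(j < size Q) Q`_j *: f (k - j%:Z).

(* h = F f, the rational function F being expanded in the direction in which   *)
(* f and h are bounded. Only meant for f and h both vanishing in all small     *)
(* enough degrees (expansion at 0) or both in all large enough ones (expansion *)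
(* at infinity): h is then determined by F and f.                              *)
Definition frac_mul_ser F f h : Prop := exists P Q,
  [/\ Q != 0, F = tofrac P / tofrac Q & pmul_ser Q h = pmul_ser P f].

Definition laurent f : Prop := exists N : int, forall k, k < N -> f k = 0.

(* having a rational expression: a Laurent series with coefficients in T that  *)
(* becomes a Laurent polynomial after multiplication by some nonzero Q(u)      *)
Definition rational_ser f : Prop :=
  laurent f /\ exists2 Q, Q != 0 &
    exists M : int, forall k, M < k -> pmul_ser Q f k = 0.

End Series.

Definition regular_at (K : fieldType) (c : K) (F : {fraction {poly K}}) : Prop :=
  exists P Q : {poly K}, Q.[c] != 0 /\ F = tofrac P / tofrac Q.

Definition regular_nonzero_at (K : fieldType) (c : K)
    (F : {fraction {poly K}}) : Prop :=
  exists P Q : {poly K}, [/\ P.[c] != 0, Q.[c] != 0 & F = tofrac P / tofrac Q].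

Section Exp.
Variables (K : fieldType) (V : lmodType K) (H : nat -> V -> V).

(* coefficient of y^r in (sum_(m > 0) H_m y^m)^k *)
Fixpoint pow_coef (k r : nat) : V -> V :=
  match k with
  | 0 => fun v => if r == 0%N then v else 0
  | k'.+1 => fun v => \sum_(m < r) H m.+1 (pow_coef k' (r - m.+1) v)
  end.

(* coefficient of y^r in exp (sum_(m > 0) H_m y^m) *)
Definition exp_coef (r : nat) (v : V) : V :=
  \sum_(k < r.+1) (k`!%:R)^-1 *: pow_coef k r v.

End Exp.

Definition coweight (n : nat) := {ffun 'I_n -> int}.

Section ShiftedQuantumAffine.
Variables (K : fieldType) (n : nat) (C : 'M[int]_n) (d : 'I_n -> nat) (q : K).
Implicit Types (i j : 'I_n) (J : {set 'I_n}) (e : bool) (r s : int).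

(* A coweight nu is given by its coordinates nu i = alpha_i(nu) in the basis   *)
(* of fundamental coweights.                                                   *)
Definition in_coweight J (nu : coweight n) : Prop :=
  forall i, i \notin J -> nu i = 0.

Definition res_coweight J (mu : coweight n) : coweight n :=
  [ffun i => if i \in J then mu i else 0].

(* The sign +/- is the boolean true/false. *)
Definition pm e : int := if e then 1 else -1.

Definition q_ i : K := q ^+ d i.

Definition qint (x : K) (m : int) : K := (x ^ m - x ^ (- m)) / (x - x^-1).
Definition qfact (x : K) (m : nat) : K := \prod_(1 <= k < m.+1) qint x k%:Z.
Definition qbin (x : K) (p l : nat) : K :=
  qfact x p / (qfact x l * qfact x (p - l)).

(* A vector space with operators x^e_(i, r) and phi^e_(i, r). For a            *)
(* U_q^nu(g_J)-module only the operators with i in J are relevant, so that     *)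
(* the restriction functor from g to g_J leaves this data unchanged.           *)
Record loop_module := LoopModule {
  lm_carrier :> lmodType K;
  lm_x : bool -> 'I_n -> int -> {linear lm_carrier -> lm_carrier};
  lm_phi : bool -> 'I_n -> int -> {linear lm_carrier -> lm_carrier}
}.

(* nu(i, +) = 0 and nu(i, -) = alpha_i(nu) *)
Definition lead (nu : coweight n) e i : int := if e then 0 else nu i.

Definition xprod (V : loop_module) e i (rs : seq int) (v : V) : V :=
  foldr (fun r w => lm_x V e i r w) v rs.

Definition h_spec J (nu : coweight n) (V : loop_module)
    (h : 'I_n -> int -> {linear V -> V}) : Prop :=
  forall e i (r : nat) (v : V), i \in J ->
    lm_phi V e i (lead nu e i + pm e * r%:Z) v =
    lm_phi V e i (lead nu e i)
      (exp_coef (fun m w =>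
         ((pm e)%:~R * (q_ i - (q_ i)^-1)) *: h i (pm e * m%:Z) w) r v).

(* The defining relations of U_q^nu(g_J), as identities between operators. The *)
(* h_(i, m) are uniquely determined by h_spec, phi^e_(i, nu(i, e)) being       *)
(* invertible.                                                                 *)
Record is_module J (nu : coweight n) (V : loop_module) : Prop := {
  phi_plus_lt0 : forall i r (v : V), i \in J -> r < 0 -> lm_phi V true i r v = 0;
  phi_minus_gt : forall i r (v : V), i \in J -> nu i < r ->
    lm_phi V false i r v = 0;
  phi_lead_inv : forall e i, i \in J -> bijective (lm_phi V e i (lead nu e i));
  phi_comm : forall e e' i j r s (v : V), i \in J -> j \in J ->
    lm_phi V e i r (lm_phi V e' j s v) = lm_phi V e' j s (lm_phi V e i r v);
  phi_plus_x : forall e i j r (v : V), i \in J -> j \in J ->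
    lm_phi V true i 0 (lm_x V e j r v) =
    (q_ i) ^ (pm e * C i j) *: lm_x V e j r (lm_phi V true i 0 v);
  phi_minus_x : forall e i j r (v : V), i \in J -> j \in J ->
    lm_phi V false i (nu i) (lm_x V e j r v) =
    (q_ i) ^ (- (pm e * C i j)) *: lm_x V e j r (lm_phi V false i (nu i) v);
  h_x : exists2 h : 'I_n -> int -> {linear V -> V}, h_spec J nu h &
    forall e i j r (m : int) (v : V), i \in J -> j \in J -> m != 0 ->
      h i m (lm_x V e j r v) - lm_x V e j r (h i m v) =
      ((pm e)%:~R * (m%:~R)^-1 * qint (q_ i) (m * C i j)) *:
        lm_x V e j (m + r) v;
  x_plus_minus : forall i j r s (v : V), i \in J -> j \in J ->
    (q_ i - (q_ i)^-1) *:
      (lm_x V true i r (lm_x V false j s v) -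
       lm_x V false j s (lm_x V true i r v)) =
    if i == j then lm_phi V true i (r + s) v - lm_phi V false j (r + s) v else 0;
  x_quadratic : forall e i j r s (v : V), i \in J -> j \in J ->
    lm_x V e i (r + 1) (lm_x V e j s v) -
      (q_ i) ^ (pm e * C i j) *: lm_x V e j s (lm_x V e i (r + 1) v) =
    (q_ i) ^ (pm e * C i j) *: lm_x V e i r (lm_x V e j (s + 1) v) -
      lm_x V e j (s + 1) (lm_x V e i r v);
  x_serre : forall e i j (p : nat) (r' : int) (r : 'I_p -> int) (v : V),
    i \in J -> j \in J -> i != j -> p%:Z = 1 - C i j ->
    \sum_(w : 'S_p) \sum_(l < p.+1)
      ((-1) ^+ l * qbin (q_ i) p l) *:
        xprod e i (take l [seq r (w k) | k <- enum 'I_p])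
          (lm_x V e j r'
            (xprod e i (drop l [seq r (w k) | k <- enum 'I_p]) v)) = 0
}.

(* the torus of J-tuples of nonzero scalars, extended by 1 outside J *)
Definition torus J (g : 'I_n -> K) : Prop :=
  (forall i, i \in J -> g i != 0) /\ (forall i, i \notin J -> g i = 1).

Definition torus_le J (g g' : 'I_n -> K) : Prop :=
  exists a : 'I_n -> nat, forall j, j \in J ->
    g' j / g j = \prod_(i in J) (q_ j) ^ ((a i)%:Z * C j i).

(* V_gamma^+ for e = true and V_gamma^- for e = false *)
Definition weight_space J (nu : coweight n) (V : loop_module) e
    (g : 'I_n -> K) (v : V) : Prop :=
  forall i, i \in J -> lm_phi V e i (lead nu e i) v = (g i) ^ (pm e) *: v.

(* The sum of the V_gamma^+ (resp. of the V_gamma^-) is always direct, these   *)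
(* being simultaneous eigenspaces with distinct systems of eigenvalues.        *)
Record in_O J (nu : coweight n) (V : loop_module) : Prop := {
  O_module : is_module J nu V;
  O_sum : forall e (v : V), exists2 s : seq V, v = \sum_(w <- s) w &
    forall w, w \in s -> exists2 g, torus J g & weight_space J nu e g w;
  O_findim : forall e g, torus J g -> exists (N : nat) (b : 'I_N -> V),
    forall v : V, weight_space J nu e g v ->
      exists c : 'I_N -> K, v = \sum_k c k *: b k;
  O_bounded : exists (N : nat) (lam : 'I_N -> 'I_n -> K),
    (forall k, torus J (lam k)) /\
    forall e g (v : V), torus J g -> v != 0 -> weight_space J nu e g v ->
      exists k, torus_le J g (lam k)
}.

(* sub_phi_inv: stability under the inverses of the phi^e_(i, nu(i, e)) *)
Record submodule J (nu : coweight n) (V : loop_module) (S : V -> Prop) : Prop := {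
  sub_zero : S 0;
  sub_lin : forall (a : K) v w, S v -> S w -> S (a *: v + w);
  sub_x : forall e i r v, i \in J -> S v -> S (lm_x V e i r v);
  sub_phi : forall e i r v, i \in J -> S v -> S (lm_phi V e i r v);
  sub_phi_inv : forall e i v, i \in J -> S (lm_phi V e i (lead nu e i) v) -> S v
}.

(* phi_j^+(z) v vanishes in negative degrees and phi_j^-(z) v in large ones,   *)
(* so frac_mul_ser expands Psi_j at 0 and at infinity respectively.            *)
Record hl_vector J (nu : coweight n) (V : loop_module) (v : V) : Prop := {
  hl_neq0 : v != 0;
  hl_x : forall j r, j \in J -> lm_x V true j r v = 0;
  hl_phi : exists2 Psi : 'I_n -> {fraction {poly K}},
    (forall j, j \in J -> regular_nonzero_at 0 (Psi j)) &
    (forall e j, j \in J ->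
       frac_mul_ser (Psi j) (cst_ser v) (fun r => lm_phi V e j r v));
  hl_gen : forall S : V -> Prop, submodule J nu S -> S v -> forall w, S w
}.

Definition hl_module J (nu : coweight n) (V : loop_module) : Prop :=
  in_O J nu V /\ exists v : V, hl_vector J nu v.

Section Fusion.
Variables (V1 V2 : loop_module).
Local Notation T := (tensor V1 V2).
Implicit Types f g : int -> T.

(* The action of phi^e_(i, r) and x^e_(i, r) on (V1 (x) V2)((u)) through the   *)
(* Drinfeld coproduct: coefficient of z^r in Delta^(u), applied to f. All      *)
(* sums over Z below have finite support for f a Laurent series.               *)
Definition Delta_phi e i r f : int -> T := fun k =>
  \sum_(t \in [set: int]%classic)
    tmap (lm_phi V1 e i (r - t)) (lm_phi V2 e i t) (f (k - t)).

Definition Delta_x_plus i r f : int -> T := fun k =>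
  tmap (lm_x V1 true i r) id (f k) +
  \sum_(t \in [set: int]%classic)
    tmap (lm_phi V1 false i (r - t)) (lm_x V2 true i t) (f (k - t)).

Definition Delta_x_minus i r f : int -> T := fun k =>
  tmap id (lm_x V2 false i r) (f (k - r)) +
  \sum_(t \in [set: int]%classic)
    tmap (lm_x V1 false i (r - t)) (lm_phi V2 true i t) (f (k - t)).

Definition Delta_x e := if e then Delta_x_plus else Delta_x_minus.

(* (A (x) U_q^nu(g_J))-submodules of (V1 (x) V2)(u), A being the ring of       *)
(* rational functions regular at u = 1 *)
Record ser_submodule J (nu : coweight n) (S : (int -> T) -> Prop) : Prop := {
  ser_rational : forall f, S f -> rational_ser f;
  ser_zero : S (fun=> 0);
  ser_add : forall f g, S f -> S g -> S (fun k => f k + g k);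
  ser_scale : forall F f g, regular_at 1 F -> S f -> laurent g ->
    frac_mul_ser F f g -> S g;
  ser_x : forall e i r f, i \in J -> S f -> S (Delta_x e i r f);
  ser_phi : forall e i r f, i \in J -> S f -> S (Delta_phi e i r f);
  ser_phi_inv : forall e i f, i \in J -> rational_ser f ->
    S (Delta_phi e i (lead nu e i) f) -> S f
}.

Definition fusion_lattice J (nu : coweight n) (v1 : V1) (v2 : V2) f : Prop :=
  forall S, ser_submodule J nu S -> S (cst_ser (pure v1 v2)) -> S f.

(* V is isomorphic to X / (u - 1) X *)
Definition fusion_quotient J (nu : coweight n) (v1 : V1) (v2 : V2)
    (V : loop_module) : Prop :=
  let X := fusion_lattice J nu v1 v2 in
  exists pi : (int -> T) -> V,
  [/\ forall (a : K) f g, X f -> X g ->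
        pi (fun k => a *: f k + g k) = a *: pi f + pi g,
      forall v, exists2 f, X f & pi f = v,
      forall f, X f ->
        (pi f = 0 <-> exists2 g, X g & f = pmul_ser ('X - 1) g),
      forall e i r f, i \in J -> X f ->
        pi (Delta_x e i r f) = lm_x V e i r (pi f)
    & forall e i r f, i \in J -> X f ->
        pi (Delta_phi e i r f) = lm_phi V e i r (pi f)].

End Fusion.

(* V represents the fusion product of the highest l-weight modules V1 and V2,  *)
(* which is a highest l-weight object of category O.                           *)
Definition is_fusion J (nu1 nu2 : coweight n) (V1 V2 V : loop_module) : Prop :=
  [/\ hl_module J nu1 V1, hl_module J nu2 V2, hl_module J (nu1 + nu2) V &
      exists (v1 : V1) (v2 : V2),
        [/\ hl_vector J nu1 v1, hl_vector J nu2 v2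
          & fusion_quotient J (nu1 + nu2) v1 v2 V]].

(* V represents V_0 * ... * V_(m-1), bracketed to the left. *)
Inductive is_iter_fusion J (nu : nat -> coweight n) (V : nat -> loop_module) :
    nat -> loop_module -> Prop :=
| iter_fusion1 : is_iter_fusion J nu V 1 (V 0%N)
| iter_fusionS (m : nat) (X Y : loop_module) : is_iter_fusion J nu V m X ->
    is_fusion J (\sum_(k < m) nu k) (nu m) X (V m) Y ->
    is_iter_fusion J nu V m.+1 Y.

Definition loop_iso J (V W : loop_module) : Prop :=
  exists theta : {linear V -> W}, [/\ bijective theta,
    forall e i r v, i \in J -> theta (lm_x V e i r v) = lm_x W e i r (theta v) &
    forall e i r v, i \in J ->
      theta (lm_phi V e i r v) = lm_phi W e i r (theta v)].

Definition is_inflation J (nu mu : coweight n) (W V : loop_module) : Prop :=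
  [/\ in_O J nu W, res_coweight J mu = nu, in_O [set: 'I_n]%SET mu V,
      loop_iso J V W &
      forall e i r (v : V), i \notin J -> lm_x V e i r v = 0].

End ShiftedQuantumAffine.

(* Main.v *)
From HB Require Import structures.
Require Import Defs.
From mathcomp Require Import all_boot all_order all_algebra perm.
From mathcomp Require Import fraction generic_quotient.
From mathcomp Require Import boolp classical_sets fsbigop complex reals.
From mathcomp Require Import zify.

(* On a J-inflation the generators x_i, i not in J, vanish, so that phi_i^+     *)
(* and phi_i^- coincide; moreover phi_i(z) x_j(w) = g_ij(z/w) x_j(w) phi_i(z)   *)
(* for a scalar series g_ij which does not depend on the module. Hence          *)
(* phi_i(z) (x) phi_i(zu) quasi-commutes, through the same series, with the     *)
(* Drinfeld coproduct of x_j(w). Since its modes multiply v_1 (x) v_2 by        *)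
(* Laurent polynomials in u, the lattice generated by v_1 (x) v_2 over g_J is   *)
(* already stable under the whole algebra, and the lattices computing the       *)
(* fusion products over g and over g_J are the same. The highest l-weight       *)
(* vectors they are built from agree up to scalars, such a vector being unique  *)
(* in its module: the weight of any other one would be both lower and higher.   *)

Set Implicit Arguments.
Unset Strict Implicit.
Unset Printing Implicit Defensive.

Import Order.TTheory GRing.Theory Num.Theory.
Local Open Scope ring_scope.

(** * Exponentials of operators and quasi-commutation *)

(** The case of m factors follows from that of two by induction on the left bracketing
    ([is_iter_fusion_inflation]). For two factors, both fusion products have the form X / (u - 1) X,
    where X is the lattice generated by one tensor of highest l-weight vectors, over g for the V's
    and over g_J for the W's. If [tens th1 th2], built from the isomorphisms [th1], [th2] of the
    inflations with the W's, identifies the two lattices, it induces the required isomorphism of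
    quotients ([is_fusion_inflation]).

    Two facts are needed. The first is that passing from g_J to g does not enlarge the lattice
    ([fusion_lattice_restrict]). For i outside J, the x_i act by zero on both factors, hence through
    the coproduct, and the relation between x_i^+ and x_i^- then forces phi_i^- = phi_i^+. There
    remain the modes of phi_i^+ and the inverses of leading modes. Exponentiating the commutators
    with the h_(i, m) gives phi_i(z) x_j(w) = g(z/w) x_j(w) phi_i(z) with g independent of the
    module ([exp_coef_comm], [phi_x_comm]). Since g is the same on both tensor factors, phi_i(z) (x)
    phi_i(zu) obeys the same rule with both summands of the coproduct of x_j ([diag_Delta_x]). Its
    modes multiply v1 (x) v2 by Laurent polynomials in u. Hence the elements of the g_J-lattice that
    all these modes send into the lattice form a g_J-stable lattice containing the generator, which
    is therefore the whole lattice ([diag_lattice]).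

    The second is that the generators match. The same stability argument shows that a highest
    l-weight vector of an inflation still generates over g_J ([sing_gen_restrict]). Such a generator
    is unique up to a scalar ([sing_gen_unique]): the module is spanned by the vectors that the x^-
    produce from it, so two generators have weights each lower than the other, and positive
    definiteness of the Cartan matrix makes these weights equal. *)

Section LinearFacts.
Variables (K : fieldType) (U V : lmodType K) (f : U -> V).
Hypothesis lf : linear f.

Lemma linear_fun0 : f 0 = 0.
Proof. by have := lf (-1) 0 0; rewrite scaler0 addr0 scaleN1r addNr. Qed.

Lemma linear_funD u v : f (u + v) = f u + f v.
Proof. by have := lf 1 u v; rewrite !scale1r. Qed.

Lemma linear_funZ a v : f (a *: v) = a *: f v.
Proof. by have := lf a v 0; rewrite linear_fun0 !addr0. Qed.

Lemma linear_fun_sum (I : Type) (r : seq I) (P : pred I) (F : I -> U) :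
  f (\sum_(i <- r | P i) F i) = \sum_(i <- r | P i) f (F i).
Proof. exact: (big_morph f linear_funD linear_fun0). Qed.

End LinearFacts.

Section TriangularSums.
Variables (V : nmodType).

Lemma sum_triangle_diag (F : nat -> nat -> V) r :
  \sum_(a < r.+1) \sum_(b < (r - a).+1) F a b =
  \sum_(p < r.+1) \sum_(a < p.+1) F a (p - a)%N.
Proof.
elim: r => [|r IHr]; first by rewrite !big_ord1.
rewrite [RHS]big_ord_recr -IHr /= [in LHS]big_ord_recr /= subnn big_ord1.
rewrite [X in _ = _ + X]big_ord_recr /= subnn addrA; congr (_ + _).
rewrite -big_split; apply: eq_bigr => a _ /=.
by rewrite subSn -1?ltnS // big_ord_recr.
Qed.

Lemma sum_triangle_swap (F : nat -> nat -> V) r :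
  \sum_(a < r.+1) \sum_(b < (r - a).+1) F a b =
  \sum_(b < r.+1) \sum_(a < (r - b).+1) F a b.
Proof.
rewrite sum_triangle_diag (sum_triangle_diag (fun b a => F a b)).
apply: eq_bigr => p _; rewrite (reindex_inj rev_ord_inj) /=.
apply: eq_bigr => a _; rewrite subSS subKn //.
by rewrite -ltnS.
Qed.

End TriangularSums.

Section ExpCommutation.
Variables (K : fieldType) (V : lmodType K) (H : nat -> V -> V).
Variables (X : int -> V -> V) (sg : int) (lam : nat -> K).
Hypothesis char0 : forall k, k.+1%:R != 0 :> K.
Hypothesis linH : forall m, linear (H m).
Hypothesis linX : forall s, linear (X s).
Hypothesis commHX : forall m s v,
  H m.+1 (X s v) = X s (H m.+1 v) + lam m.+1 *: X (s + sg * m.+1%:Z) v.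

(** Both series start in degree 1; padding them by 0 in degree 0 lets all Cauchy products run over
    full triangles. *)
Let H0 a v := if a is 0 then 0 else H a v.
Let lam0 a := if a is 0 then 0 else lam a.

(** Coefficient of y^m in the l-th power of the series of the [lam a] y^a, a > 0. *)
Fixpoint lam_pow (l m : nat) : K :=
  match l with
  | 0 => (m == 0)%:R
  | l'.+1 => \sum_(a < m.+1) lam0 a * lam_pow l' (m - a)
  end.

Let linH0 a : linear (H0 a).
Proof. by case: a => [|a] c u v /=; rewrite ?scaler0 ?addr0 // linH. Qed.

Let commHX0 a s v :
  H0 a (X s v) = X s (H0 a v) + lam0 a *: X (s + sg * a%:Z) v.
Proof. by case: a => [|a] /=; rewrite ?(linear_fun0 (linX _)) ?scale0r ?addr0. Qed.

Let pow_coefS k r v :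
  pow_coef H k.+1 r v = \sum_(a < r.+1) H0 a (pow_coef H k (r - a) v).
Proof. by rewrite big_ord_recl /= add0r. Qed.

Lemma pow_coef_gt k r v : (r < k)%N -> pow_coef H k r v = 0.
Proof.
elim: k r v => // k IHk r v lt_rk /=; apply: big1 => m _.
by rewrite IHk ?(linear_fun0 (linH _)) //; have := ltn_ord m; lia.
Qed.

Lemma lam_pow_gt l m : (m < l)%N -> lam_pow l m = 0.
Proof.
elim: l m => // l IHl m lt_ml /=; apply: big1 => -[[|a] lt_a] _ /=.
  by rewrite mul0r.
by rewrite IHl ?mulr0 //; lia.
Qed.

(** Normally ordered product: the coefficient of y^r when l scalar factors lam(y) stand to the left
    of X and k factors H(y) to its right, the index of X moving with the degree taken from lam. *)
Let B (s : int) l k r v : V :=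
  \sum_(m < r.+1) lam_pow l m *: X (s + sg * m%:Z) (pow_coef H k (r - m) v).

(** Leibniz rule: a new factor H(y) either passes through X, raising k, or is absorbed by it,
    raising l. *)
Let B_step s l k r v :
  \sum_(a < r.+1) H0 a (B s l k (r - a) v) = B s l k.+1 r v + B s l.+1 k r v.
Proof.
pose F a m := lam_pow l m *: X (s + sg * m%:Z) (H0 a (pow_coef H k (r - a - m) v)).
pose G a m := (lam0 a * lam_pow l m) *:
  X (s + sg * (a + m)%N%:Z) (pow_coef H k (r - (a + m)) v).
transitivity (\sum_(a < r.+1) \sum_(m < (r - a).+1) F a m +
              \sum_(a < r.+1) \sum_(m < (r - a).+1) G a m).
  rewrite -big_split; apply: eq_bigr => a _ /=.
  rewrite (linear_fun_sum (linH0 _)) -big_split; apply: eq_bigr => m _ /=.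
  rewrite (linear_funZ (linH0 _)) commHX0 scalerDr /F /G; congr (_ + _).
  rewrite scalerA mulrC subnDA PoszD; congr (_ *: X _ _).
  by rewrite mulrDr addrA addrAC.
rewrite sum_triangle_swap sum_triangle_diag; congr (_ + _); apply: eq_bigr => m _.
  rewrite pow_coefS (linear_fun_sum (linX _)) scaler_sumr.
  by apply: eq_bigr => a _; rewrite /F subnAC.
rewrite /= scaler_suml; apply: eq_bigr => a _.
by rewrite /G subnKC // -ltnS.
Qed.

(** By [B_step], each factor H(y) raises k or l by one, so moving k of them across X produces
    binomial coefficients, through Pascal's rule. *)
Lemma pow_coef_comm k r s v :
  pow_coef H k r (X s v) =
  \sum_(l < k.+1) \sum_(m < r.+1) ('C(k, l)%:R * lam_pow l m) *:
    X (s + sg * m%:Z) (pow_coef H (k - l) (r - m) v).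
Proof.
suff -> : pow_coef H k r (X s v) =
    \sum_(l < k.+1) 'C(k, l)%:R *: B s l (k - l) r v.
  apply: eq_bigr => l _; rewrite scaler_sumr.
  by apply: eq_bigr => m _; rewrite scalerA.
elim: k r => [|k IHk] r.
  rewrite big_ord1 bin0 scale1r /B (bigD1 ord0) //= big1 ?addr0; last first.
    by move=> [[|m] lt_m] //= _; rewrite scale0r.
  rewrite scale1r subn0 mulr0 addr0.
  by case: ifP => // _; rewrite (linear_fun0 (linX _)).
rewrite pow_coefS.
under eq_bigr => a _ do rewrite IHk (linear_fun_sum (linH0 _)).
rewrite exchange_big /=.
under eq_bigr => l _.
  under eq_bigr => a _ do rewrite (linear_funZ (linH0 _)).
  rewrite -scaler_sumr B_step scalerDr.
  over.
rewrite big_split /= [in RHS]big_ord_recl.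
under [in RHS]eq_bigr => l _.
  rewrite lift0 binS natrD scalerDl subSS.
  over.
rewrite big_split /= addrA; congr (_ + _).
rewrite [in LHS]big_ord_recl [in RHS]big_ord_recr /= !bin0 subn0.
rewrite bin_small // scale0r addr0; congr (_ + _).
by apply: eq_bigr => l _; rewrite /bump /= add1n subnSK.
Qed.

(** This is exp(H) X = exp(lam) X exp(H): dividing the binomial formula by k! turns 'C(k, l) into 1
    / (l! (k - l)!), and the double sum splits into two exponentials. *)
Lemma exp_coef_comm r s v :
  exp_coef H r (X s v) =
  \sum_(m < r.+1) (\sum_(l < m.+1) (l`!%:R)^-1 * lam_pow l m) *:
    X (s + sg * m%:Z) (exp_coef H (r - m) v).
Proof.
have natr_neq0 k : (0 < k)%N -> k%:R != 0 :> K by case: k.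
pose T l k m := ((l`!%:R)^-1 * (k`!%:R)^-1 * lam_pow l m) *:
    X (s + sg * m%:Z) (pow_coef H k (r - m) v).
have T0 l k m : (m < l)%N || (r - m < k)%N -> T l k m = 0.
  rewrite /T => /orP[lt_ml|lt_rmk]; first by rewrite lam_pow_gt // mulr0 scale0r.
  by rewrite pow_coef_gt // (linear_fun0 (linX _)) scaler0.
(* As [T l k m] vanishes unless l <= m and k <= r - m, every range can be enlarged to [r.+1], after
   which the three sums are permuted freely. *)
have widen N M (F : nat -> V) : (N <= M)%N -> (forall k, (N <= k)%N -> F k = 0) ->
    \sum_(k < N) F k = \sum_(k < M) F k.
  move=> le_NM F0; rewrite (big_ord_widen _ _ le_NM) big_mkcond /=.
  apply: eq_bigr => k _; case: ifP => // /negbT; rewrite -leqNgt => ?.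
  by rewrite F0.
transitivity (\sum_(l < r.+1) \sum_(k < r.+1) \sum_(m < r.+1) T l k m).
  transitivity (\sum_(k < r.+1) \sum_(l < k.+1) \sum_(m < r.+1) T l (k - l)%N m).
    apply: eq_bigr => k _; rewrite pow_coef_comm scaler_sumr.
    apply: eq_bigr => l _; rewrite scaler_sumr; apply: eq_bigr => m _.
    rewrite scalerA mulrA; congr (_ * _ *: _).
    have le_lk : (l <= k)%N by rewrite -ltnS.
    rewrite -(bin_fact le_lk) !natrM invfM mulrAC mulVf ?mul1r ?invfM //.
    by rewrite natr_neq0 // bin_gt0.
  rewrite -(sum_triangle_diag (fun l k => \sum_(m < r.+1) T l k m)).
  apply: eq_bigr => l _; have lt_l := ltn_ord l.
  apply: (widen _ _ (fun k => \sum_(m < r.+1) T l k m)); first lia.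
  by move=> k lt_k; apply: big1 => m _; apply: T0; have := ltn_ord m; lia.
under eq_bigr do rewrite exchange_big.
rewrite exchange_big; apply: eq_bigr => m _ /=; have lt_m := ltn_ord m.
rewrite scaler_suml -(widen m.+1 r.+1 (fun l => \sum_(k < r.+1) T l k m)) //; last first.
  by move=> l lt_l; apply: big1 => k _; apply: T0; lia.
apply: eq_bigr => l _.
rewrite -(widen (r - m).+1 r.+1 (fun k => T l k m)); [|lia|]; last first.
  by move=> k lt_k; apply: T0; lia.
rewrite /exp_coef (linear_fun_sum (linX _)) scaler_sumr.
apply: eq_bigr => k _; rewrite (linear_funZ (linX _)) scalerA /T.
by congr (_ *: _); rewrite mulrAC.
Qed.

End ExpCommutation.

(** * Tensor products, sums over the integers, formal series *)

Section TensorMap.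
Variables (K : fieldType).

(** Extends [tmap] to maps between different spaces, as transport along isomorphisms requires; on
    endomorphisms the two are convertible. *)
Definition tens (V1 V2 W1 W2 : lmodType K) (f : V1 -> W1) (g : V2 -> W2)
    (x : tensor V1 V2) : tensor W1 W2 :=
  \sum_(p <- repr x) pure (f p.1) (g p.2).

Section Pure.
Variables (V1 V2 : lmodType K).
Implicit Types (v : V1) (w : V2).

Lemma pureDl v v' w : pure (v + v') w = pure v w + pure v' w.
Proof. exact: (linear_funD ((pure_bilinear V1 V2).1 w)). Qed.

Lemma pureDr v w w' : pure v (w + w') = pure v w + pure v w'.
Proof. exact: (linear_funD ((pure_bilinear V1 V2).2 v)). Qed.

Lemma pureZl a v w : pure (a *: v) w = a *: pure v w.
Proof. exact: (linear_funZ ((pure_bilinear V1 V2).1 w)). Qed.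

Lemma pureZr a v w : pure v (a *: w) = a *: pure v w.
Proof. exact: (linear_funZ ((pure_bilinear V1 V2).2 v)). Qed.

Lemma pure0l w : pure (0 : V1) w = 0.
Proof. exact: (linear_fun0 ((pure_bilinear V1 V2).1 w)). Qed.

Lemma pure0r v : pure v (0 : V2) = 0.
Proof. exact: (linear_fun0 ((pure_bilinear V1 V2).2 v)). Qed.

End Pure.

Section Basics.
Variables (V1 V2 W1 W2 : lmodType K).
Implicit Types (f : {linear V1 -> W1}) (g : {linear V2 -> W2}).
Implicit Types (v : V1) (w : V2) (x y : tensor V1 V2).

Lemma tens_bilinear f g : bilinear_map (fun v w => pure (f v) (g w)).
Proof.
by split=> [w|v] a u u' /=; rewrite linearP ?pureDl ?pureDr ?pureZl ?pureZr.
Qed.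

Lemma tens_linear f g : linear (tens f g).
Proof.
move=> a x y; have bfg := tens_bilinear f g.
rewrite /tens -!/(tensor_eval (fun v w => pure (f v) (g w)) _).
by rewrite tensor_repr_eval // tensor_eval_cat tensor_repr_eval //
  tensor_eval_scale.
Qed.

Lemma tens_pure f g v w : tens f g (pure v w) = pure (f v) (g w).
Proof.
rewrite /tens -/(tensor_eval (fun v w => pure (f v) (g w)) _).
by rewrite (tensor_repr_eval _ (tens_bilinear f g)) /tensor_eval big_seq1.
Qed.

Lemma eq_tens (f f' : V1 -> W1) (g g' : V2 -> W2) :
  f =1 f' -> g =1 g' -> tens f g =1 tens f' g'.
Proof. by move=> ef eg x; apply: eq_bigr => p _; rewrite ef eg. Qed.

Lemma tens0l (f : V1 -> W1) (g : V2 -> W2) x : (forall v, f v = 0) -> tens f g x = 0.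
Proof. by move=> f0; apply: big1 => p _; rewrite f0 pure0l. Qed.

Lemma tens0r (f : V1 -> W1) (g : V2 -> W2) x : (forall w, g w = 0) -> tens f g x = 0.
Proof. by move=> g0; apply: big1 => p _; rewrite g0 pure0r. Qed.

Lemma tens_suml (I : Type) (r : seq I) (c : I -> K) (f : I -> V1 -> W1)
    (h : V1 -> W1) (g : V2 -> W2) x :
  (forall v, h v = \sum_(i <- r) c i *: f i v) ->
  tens h g x = \sum_(i <- r) c i *: tens (f i) g x.
Proof.
move=> hE; rewrite (eq_tens hE (frefl g)) /tens.
under [RHS]eq_bigr do rewrite scaler_sumr.
rewrite exchange_big; apply: eq_bigr => p _ /=.
rewrite (linear_fun_sum ((pure_bilinear W1 W2).1 _)).
by apply: eq_bigr => i _; rewrite pureZl.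
Qed.

Lemma tens_sumr (I : Type) (r : seq I) (c : I -> K) (f : V1 -> W1)
    (g : I -> V2 -> W2) (h : V2 -> W2) x :
  (forall w, h w = \sum_(i <- r) c i *: g i w) ->
  tens f h x = \sum_(i <- r) c i *: tens f (g i) x.
Proof.
move=> hE; rewrite (eq_tens (frefl f) hE) /tens.
under [RHS]eq_bigr do rewrite scaler_sumr.
rewrite exchange_big; apply: eq_bigr => p _ /=.
rewrite (linear_fun_sum ((pure_bilinear W1 W2).2 _)).
by apply: eq_bigr => i _; rewrite pureZr.
Qed.

End Basics.

Lemma tens_comp (V1 V2 W1 W2 U1 U2 : lmodType K)
    (f : {linear V1 -> W1}) (g : {linear V2 -> W2})
    (f' : {linear W1 -> U1}) (g' : {linear W2 -> U2}) x :
  tens f' g' (tens f g x) = tens (f' \o f) (g' \o g) x.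
Proof.
rewrite [tens f g x]/tens (linear_fun_sum (tens_linear f' g')).
by apply: eq_bigr => p _; rewrite tens_pure.
Qed.

Lemma tens_id (V1 V2 : lmodType K) (x : tensor V1 V2) : tens id id x = x.
Proof. by rewrite [RHS]tensor_sum_pure. Qed.

End TensorMap.

Section IntSums.
Variables (K : fieldType) (T : lmodType K).
Implicit Types (F G : int -> T) (s : seq int).

Definition fsum F : T := \sum_(t \in [set: int]%classic) F t.

Definition finsupp F := exists s, forall t, t \notin s -> F t = 0.

Lemma fsumE s F : uniq s -> (forall t, t \notin s -> F t = 0) ->
  fsum F = \sum_(t <- s) F t.
Proof. move=> us F0; rewrite /fsum (fsbigE s) //; last by move=> t _ /F0.
by apply: eq_bigl => t; rewrite in_setT. Qed.

Lemma eq_fsum F G : F =1 G -> fsum F = fsum G.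
Proof. by move=> eFG; congr fsum; apply: funext. Qed.

Lemma fsum0 F : (forall t, F t = 0) -> fsum F = 0.
Proof. by move=> F0; rewrite /fsum fsbig1. Qed.

Lemma fsum1 c F : (forall t, t != c -> F t = 0) -> fsum F = F c.
Proof.
by move=> F0; rewrite (@fsumE [:: c]) ?big_seq1 // => t; rewrite inE => /F0.
Qed.

Lemma fsum_shift c F : fsum F = fsum (fun t => F (t + c)).
Proof.
rewrite /fsum (reindex_fsbigT (fun t => t + c)) //.
by exists (fun t => t - c) => t; rewrite ?addrK ?subrK.
Qed.

Lemma finsuppP F : finsupp F ->
  exists2 s, uniq s & forall t, t \notin s -> F t = 0.
Proof.
case=> s F0; exists (undup s); first exact: undup_uniq.
by move=> t; rewrite mem_undup => /F0.
Qed.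

Lemma int_interval_seq (a b : int) :
  exists ts : seq int, forall t, t \notin ts -> (t < a) || (b < t).
Proof.
exists [seq a + k%:Z | k <- iota 0 (absz (b - a)).+1] => t.
apply: contraR; rewrite negb_or -!leNgt => /andP[le_at le_tb].
by apply/mapP; exists (absz (t - a)); rewrite ?mem_iota; lia.
Qed.

Lemma finsupp_bounds (a b : int) F :
  (forall t, t < a -> F t = 0) -> (forall t, b < t -> F t = 0) -> finsupp F.
Proof.
move=> Fa Fb; have [ts hts] := int_interval_seq a b.
by exists ts => t /hts /orP[/Fa|/Fb].
Qed.

Lemma fsum_comb (I : Type) (r : seq I) (c : I -> K) (F : I -> int -> T) :
  (forall i, finsupp (F i)) ->
  fsum (fun t => \sum_(i <- r) c i *: F i t) = \sum_(i <- r) c i *: fsum (F i).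
Proof.
move=> hF; elim: r => [|i r IHr].
  by rewrite big_nil; apply: fsum0 => t; rewrite big_nil.
rewrite big_cons -IHr; have [s Fi0] := hF i.
have [s' F0] : finsupp (fun t => \sum_(i <- r) c i *: F i t).
  elim: {IHr} r => [|j r [s' F0]]; first by exists [::] => t _; rewrite big_nil.
  have [s'' Fj0] := hF j; exists (s'' ++ s') => t.
  rewrite mem_cat negb_or => /andP[/Fj0 e /F0 e'].
  by rewrite big_cons e e' scaler0 addr0.
have us : uniq (undup (s ++ s')) by apply: undup_uniq.
rewrite !(@fsumE (undup (s ++ s'))) // => [||t|t].
- rewrite scaler_sumr -big_split; apply: eq_bigr => t _ /=.
  by rewrite big_cons.
- by move=> t; rewrite mem_undup mem_cat negb_or => /andP[_ /F0].
- by rewrite mem_undup mem_cat negb_or => /andP[/Fi0].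
rewrite mem_undup mem_cat negb_or big_cons => /andP[/Fi0 -> /F0 ->].
by rewrite scaler0 addr0.
Qed.

Lemma fsum_exchange s1 s2 (F : int -> int -> T) :
  (forall t p, t \notin s1 -> F t p = 0) ->
  (forall t p, p \notin s2 -> F t p = 0) ->
  fsum (fun t => fsum (F t)) = fsum (fun p => fsum (F^~ p)).
Proof.
move=> F1 F2; have u1 := undup_uniq s1; have u2 := undup_uniq s2.
rewrite (fsumE u1); last first.
  by move=> t; rewrite mem_undup => tN; apply: fsum0 => p; rewrite F1.
rewrite (fsumE u2); last first.
  by move=> t; rewrite mem_undup => tN; apply: fsum0 => p; rewrite F2.
under eq_bigr => t _.
  rewrite (fsumE u2); last by move=> p; rewrite mem_undup => /F2.
  over.
rewrite exchange_big; apply: eq_bigr => p _ /=.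
by rewrite (fsumE u1) // => t; rewrite mem_undup => /F1.
Qed.

End IntSums.

Lemma fsum_linear (K : fieldType) (T U : lmodType K) (f : T -> U) (F : int -> T) :
  linear f -> finsupp F -> f (fsum F) = fsum (f \o F).
Proof.
move=> lf /finsuppP[s us F0]; rewrite (fsumE us F0) (linear_fun_sum lf).
by rewrite (@fsumE _ _ s) // => t /F0 /= ->; rewrite (linear_fun0 lf).
Qed.


Section SeriesFacts.
Variables (K : fieldType) (T : lmodType K).
Implicit Types (f g h : int -> T) (P Q : {poly K}).

Lemma pmul_serE N Q f k : (size Q <= N)%N ->
  pmul_ser Q f k = \sum_(j < N) Q`_j *: f (k - j%:Z).
Proof.
move=> le_QN; rewrite /pmul_ser (big_ord_widen _ (fun j => Q`_j *: f (k - j%:Z)) le_QN).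
rewrite big_mkcond /=; apply: eq_bigr => j _; case: ltnP => // le_Qj.
by rewrite nth_default ?scale0r.
Qed.

Lemma pmul_serX f k j : pmul_ser 'X^j f k = f (k - j%:Z).
Proof.
rewrite /pmul_ser size_polyXn big_ord_recr /= coefXn eqxx scale1r big1 ?add0r //.
by move=> i _; rewrite coefXn ltn_eqF // scale0r.
Qed.

Lemma pmul_serC c f k : pmul_ser c%:P f k = c *: f k.
Proof.
by rewrite (@pmul_serE 1) ?size_polyC_leq1 // big_ord1 coefC eqxx subr0.
Qed.

Lemma pmul_ser_linear (U : lmodType K) (L : T -> U) Q f k : linear L ->
  pmul_ser Q (L \o f) k = L (pmul_ser Q f k).
Proof.
move=> lL; rewrite /pmul_ser (linear_fun_sum lL).
by apply: eq_bigr => j _; rewrite (linear_funZ lL).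
Qed.

Lemma pmul_XsubC1 f k : pmul_ser ('X - 1) f k = f (k - 1) - f k.
Proof.
rewrite (@pmul_serE 2); last by rewrite size_XsubC.
rewrite big_ord_recr big_ord1 /= !coefB !coefX !coef1 /= !subr0.
by rewrite sub0r scaleN1r scale1r addrC.
Qed.

(** On arbitrary two-sided series u - 1 is a difference operator, inverted by telescoping from
    degree 0. This serves to exclude a lattice made of all series. *)
Lemma pmul_XsubC1_surj f : exists g, pmul_ser ('X - 1) g = f.
Proof.
pose g (k : int) : T := match k with
  | Posz n => - \sum_(i < n) f i.+1%:Z
  | Negz n => \sum_(i < n.+1) f (- i%:Z) end.
exists g; apply: funext => k; rewrite pmul_XsubC1.
case: k => [[|k]|k].
- by rewrite /g /= big_ord0 big_ord1 !oppr0 addr0.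
- have -> : k.+1%:Z - 1 = k%:Z by lia.
  by rewrite /g [X in _ - - X]big_ord_recr /= opprK addrA addNr add0r.
have -> : Negz k - 1 = Negz k.+1 by lia.
rewrite /g big_ord_recr /= addrAC subrr add0r; congr f; lia.
Qed.

End SeriesFacts.

(** * Convolution operators on series *)

Section Convolution.
Variables (K : fieldType) (V1 V2 : lmodType K).
Local Notation T := (tensor V1 V2).
Implicit Types (a : int -> {linear V1 -> V1}) (b : int -> {linear V2 -> V2}).
Implicit Types (f g : int -> T) (r s t p k : int).

(** The coefficient of z^r in a(z) (x) b(zu), acting on the series f in u. Every summand of the
    Drinfeld coproduct takes this form. *)
Definition conv a b r f : int -> T :=
  fun k => fsum (fun t => tens (a (r - t)) (b t) (f (k - t))).

(** The lower bound makes the sum in [conv] finite on Laurent series. With the upper bound as well,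
    each mode is a Laurent polynomial in u, so that rational series stay rational. *)
Definition lower_bounded a b := forall r, exists B : int, forall t x,
  t < B -> tens (a (r - t)) (b t) x = 0.

Definition upper_bounded a b := forall r, exists B : int, forall t x,
  B < t -> tens (a (r - t)) (b t) x = 0.

Section Properties.
Variables (a : int -> {linear V1 -> V1}) (b : int -> {linear V2 -> V2}).
Hypothesis ab_lb : lower_bounded a b.

Lemma conv_finsupp r f k : laurent f ->
  finsupp (fun t => tens (a (r - t)) (b t) (f (k - t))).
Proof.
move=> [N fN]; have [B hB] := ab_lb r.
apply: (@finsupp_bounds _ _ B (k - N)) => t ht; first exact: hB.
by rewrite fN ?(linear_fun0 (tens_linear _ _)) //; lia.
Qed.

Lemma conv_laurent r f : laurent f -> laurent (conv a b r f).
Proof.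
move=> [N fN]; have [B hB] := ab_lb r; exists (N + B) => k hk.
apply: fsum0 => t; have [/hB -> //|le_Bt] := ltP t B.
by rewrite fN ?(linear_fun0 (tens_linear _ _)) //; lia.
Qed.

Lemma conv_comb (I : Type) (s : seq I) (c : I -> K) (f : I -> int -> T) r k :
  (forall i, laurent (f i)) ->
  conv a b r (fun k => \sum_(i <- s) c i *: f i k) k =
  \sum_(i <- s) c i *: conv a b r (f i) k.
Proof.
move=> hf; rewrite -fsum_comb => [|i]; last exact: conv_finsupp.
apply: eq_fsum => t; rewrite (linear_fun_sum (tens_linear _ _)).
by apply: eq_bigr => i _; rewrite (linear_funZ (tens_linear _ _)).
Qed.

Lemma conv0 r : conv a b r (fun=> 0) = fun=> 0.
Proof.
by apply: funext => k; apply: fsum0 => t; apply: linear_fun0; apply: tens_linear.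
Qed.

Lemma conv_lin c f g r k : laurent f -> laurent g ->
  conv a b r (fun k => c *: f k + g k) k =
  c *: conv a b r f k + conv a b r g k.
Proof.
move=> hf hg; pose F (i : bool) := if i then f else g.
have hF i : laurent (F i) by case: i.
have := @conv_comb _ [:: true; false] (fun i => if i then c else 1) F r k hF.
rewrite !big_cons !big_nil addr0 scale1r /= => <-.
congr conv; apply: funext => k'.
by rewrite !big_cons !big_nil addr0 scale1r.
Qed.

Lemma conv_pmul Q r f : laurent f ->
  conv a b r (pmul_ser Q f) = pmul_ser Q (conv a b r f).
Proof.
move=> hf; apply: funext => k; rewrite /pmul_ser.
pose F (j : 'I_(size Q)) k := f (k - j%:Z).
rewrite (@conv_comb _ _ _ F) => [|j].
  apply: eq_bigr => j _; congr (_ *: _); apply: eq_fsum => t.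
  by rewrite /F addrAC.
by have [N fN] := hf; exists N => k' lt_k'; apply: fN; lia.
Qed.

Lemma conv_frac F r f g : laurent f -> laurent g -> frac_mul_ser F f g ->
  frac_mul_ser F (conv a b r f) (conv a b r g).
Proof.
move=> hf hg [P [Q [Q0 eF e]]]; exists P, Q; split=> //.
by rewrite -!conv_pmul // e.
Qed.

Lemma conv_rational r f : upper_bounded a b -> rational_ser f ->
  rational_ser (conv a b r f).
Proof.
move=> ab_ub [hf [Q Q0 [M fM]]]; split; first exact: conv_laurent.
exists Q => //; have [B hB] := ab_ub r; exists (M + B) => k lt_k.
rewrite -conv_pmul //; apply: fsum0 => t.
have [/hB -> //|le_tB] := ltP B t.
by rewrite fM ?(linear_fun0 (tens_linear _ _)) //; lia.
Qed.

End Properties.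

Lemma conv_conv a b c d r s f k : lower_bounded a b -> laurent f ->
  conv c d r (conv a b s f) k =
  fsum (fun t => fsum (fun p =>
    tens (c (r - t)) (d t) (tens (a (s - p)) (b p) (f (k - t - p))))).
Proof.
move=> ab_lb hf; apply: eq_fsum => t.
by rewrite (fsum_linear (tens_linear _ _)) //; apply: conv_finsupp.
Qed.

Section Commutation.
Variables (a c : int -> {linear V1 -> V1}) (b d : int -> {linear V2 -> V2}).
Hypotheses (ab_lb : lower_bounded a b).
Hypotheses (cd_lb : lower_bounded c d) (cd_ub : upper_bounded c d).

(* The two variants of this commutation relation, according to the tensor      *)
(* factor in which the modes get shifted, are sh = 0 and sh m = - m.           *)
Lemma conv_comm (sh : nat -> int) (M : nat) (g : nat -> K) r s f k :
  laurent f ->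
  (forall t p x, tens (c (r - t)) (d t) (tens (a (s - p)) (b p) x) =
     \sum_(m < M) g m *: tens (a (s + m%:Z - (p - sh m))) (b (p - sh m))
       (tens (c (r - m%:Z - (t + sh m))) (d (t + sh m)) x)) ->
  conv c d r (conv a b s f) k =
  \sum_(m < M) g m *: conv a b (s + m%:Z) (conv c d (r - m%:Z) f) k.
Proof.
move=> hf hcomm; rewrite conv_conv //; have [N fN] := hf.
(* [Z m] is the summand in the target order. The index t lies in a fixed interval since [c], [d] are
   bounded on both sides; p is bounded above only because t >= B and f is Laurent. This finiteness
   justifies reindexing by [sh] and exchanging the sums. *)
pose Z m t p := tens (a (s + m%:Z - p)) (b p)
  (tens (c (r - m%:Z - t)) (d t) (f (k - t - p))).
have Z_t m : exists u1 : seq int, forall t p, t \notin u1 -> Z m t p = 0.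
  have [B hB] := cd_lb (r - m%:Z); have [B' hB'] := cd_ub (r - m%:Z).
  have [u1 hs1] := int_interval_seq B B'.
  exists u1 => t p /hs1 /orP[/hB e|/hB' e];
    by rewrite /Z e (linear_fun0 (tens_linear _ _)).
have Z_p m : exists u2 : seq int, forall t p, p \notin u2 -> Z m t p = 0.
  have [A hA] := ab_lb (s + m%:Z); have [B hB] := cd_lb (r - m%:Z).
  have [u2 hs2] := int_interval_seq A (k - B - N).
  exists u2 => t p /hs2 /orP[/hA e|lt_p]; first by rewrite /Z e.
  rewrite /Z; have [lt_t|le_t] := ltP t B.
    by rewrite hB // (linear_fun0 (tens_linear _ _)).
  by rewrite fN ?(linear_fun0 (tens_linear _ _)) //; lia.
have Zsupp m t : finsupp (Z m t) by have [u2 h] := Z_p m; exists u2 => p /h.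
transitivity (\sum_(m < M) g m *: fsum (fun t => fsum (Z m t))).
  transitivity (fsum (fun t => \sum_(m < M) g m *: fsum (Z m (t + sh m)))).
    apply: eq_fsum => t; under [RHS]eq_bigr => m _ do rewrite (fsum_shift (- sh m)).
    rewrite -fsum_comb => [|m].
      apply: eq_fsum => p; rewrite hcomm; apply: eq_bigr => m _.
      by rewrite /Z (_ : k - (t + sh m) - (p - sh m) = k - t - p) //; lia.
    have [u2 h] := Z_p m; exists [seq p + sh m | p <- u2] => p pN.
    apply: h; apply: contra pN => pN; apply/mapP; exists (p - sh m) => //.
    by rewrite subrK.
  rewrite fsum_comb => [|m].
    by apply: eq_bigr => m _; rewrite [in RHS](fsum_shift (sh m)).
  have [u1 h] := Z_t m; exists [seq t - sh m | t <- u1] => t tN.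
  apply: fsum0 => p; apply: h; apply: contra tN => tN; apply/mapP.
  by exists (t + sh m); rewrite ?addrK.
apply: eq_bigr => m _; congr (_ *: _).
have [u1 h1] := Z_t m; have [u2 h2] := Z_p m.
rewrite (fsum_exchange h1 h2) conv_conv //.
by apply: eq_fsum => p; apply: eq_fsum => t; rewrite /Z (addrAC k).
Qed.

End Commutation.

End Convolution.

(** * Eigenvectors and weights *)

Section Line.
Variables (K : fieldType) (V : lmodType K) (v : V).

Definition line (u : V) : Prop := exists c : K, u = c *: v.

Lemma line0 : line 0.
Proof. by exists 0; rewrite scale0r. Qed.

Lemma lineD u w : line u -> line w -> line (u + w).
Proof. by move=> [a ->] [b ->]; exists (a + b); rewrite scalerDl. Qed.

Lemma lineZ a u : line u -> line (a *: u).
Proof. by move=> [b ->]; exists (a * b); rewrite scalerA. Qed.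

Lemma line_sum (I : Type) (r : seq I) (P : pred I) (F : I -> V) :
  (forall i, P i -> line (F i)) -> line (\sum_(i <- r | P i) F i).
Proof. exact: (big_ind line line0 lineD). Qed.

(* Reading the coefficient of z^(r + a) in Q h = P v, where a is an extremal   *)
(* exponent of Q, expresses h r through the h r' with r' closer to the bound N. *)
Lemma line_frac_aux (P Q : {poly K}) (h : int -> V) (sg N : int) (a : nat) :
  pmul_ser Q h = pmul_ser P (cst_ser v) -> Q`_a != 0 -> (sg == 1) || (sg == -1) ->
  (forall j : nat, Q`_j != 0 -> 0 <= sg * (j%:Z - a%:Z)) ->
  (forall r, sg * (r - N) < 0 -> h r = 0) -> forall r, line (h r).
Proof.
move=> eQP Qa0 hsg hQ hN r.
have [/hN ->|] := ltP (sg * (r - N)) 0; first exact: line0.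
move=> r_ge; have [n en] : exists n : nat, sg * (r - N) = n%:Z.
  by exists (absz (sg * (r - N))); lia.
elim/ltn_ind: n r {r_ge} en => n IHn r en.
have : line (pmul_ser Q h (r + a%:Z)).
  rewrite eQP; apply: line_sum => j _; apply: lineZ; rewrite /cst_ser.
  by case: ifP => _; [exists 1; rewrite scale1r | exact: line0].
have lt_aQ : (a < size Q)%N.
  by rewrite ltnNge; apply: contra Qa0 => /(nth_default 0) ->.
rewrite /pmul_ser (bigD1 (Ordinal lt_aQ)) //= addrK => -[c hc].
have {hc} -> : h r = (Q`_a)^-1 *: (c *: v + - 1 *:
    \sum_(j < size Q | j != Ordinal lt_aQ) Q`_j *: h (r + a%:Z - j%:Z)).
  by rewrite -hc scaleN1r addrK scalerA mulVf // scale1r.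
apply: lineZ; apply: lineD; first by exists c.
apply: lineZ; apply: line_sum => j jNa.
have [->|Qj0] := eqVneq Q`_j 0; first by rewrite scale0r; apply: line0.
apply: lineZ; have := hQ _ Qj0; have ja : j != a :> nat by [].
move=> hj; have [/hN ->|r_ge] := ltP (sg * (r + a%:Z - j%:Z - N)) 0.
  exact: line0.
by apply: (IHn (absz (sg * (r + a%:Z - j%:Z - N)))); case/orP: hsg => /eqP e; lia.
Qed.

(** The recursion pivots on the lowest nonzero coefficient of Q when h is bounded below (expansion
    at 0), and on the leading one when h is bounded above (expansion at infinity). *)
Lemma line_frac_mul (F : {fraction {poly K}}) (h : int -> V) (e : bool) (N : int) :
  frac_mul_ser F (cst_ser v) h -> (forall r, pm e * (r - N) < 0 -> h r = 0) ->
  forall r, line (h r).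
Proof.
move=> [P [Q [Q0 _ eQP]]] hN.
case: e hN => hN; last first.
  apply: (line_frac_aux (a := (size Q).-1) eQP _ _ _ hN) => //.
    by rewrite -lead_coefE lead_coef_eq0.
  move=> j Qj; have : (j < size Q)%N.
    by rewrite ltnNge; apply: contra Qj => /(nth_default 0) ->.
  rewrite /pm; lia.
have exQ : exists a : nat, Q`_a != 0.
  by exists (size Q).-1; rewrite -lead_coefE lead_coef_eq0.
have [a Qa mina] := ex_minnP exQ.
apply: (line_frac_aux (a := a) eQP Qa _ _ hN) => // j /mina; rewrite /pm; lia.
Qed.

End Line.

Section CartanNondegeneracy.
Variables (K : fieldType) (n : nat) (C : 'M[int]_n) (d : 'I_n -> nat) (q : K).
Hypotheses (hC : simple_cartan C d) (q0 : q != 0).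
Hypothesis q_not_root : forall k : nat, (0 < k)%N -> q ^+ k != 1.

Lemma expz_eq1 (m : int) : q ^ m = 1 -> m = 0.
Proof.
case: m => [[|m]|m] //.
  by move=> e; have := q_not_root (ltn0Sn m); rewrite -exprnP in e; rewrite e eqxx.
rewrite NegzE -exprnN => /(congr1 GRing.inv); rewrite invrK invr1 => e.
by have := q_not_root (ltn0Sn m); rewrite e eqxx.
Qed.

Lemma q_neq0 i : q_ d q i != 0.
Proof. by rewrite expf_neq0. Qed.

Lemma q_subV_neq0 i : q_ d q i - (q_ d q i)^-1 != 0.
Proof.
rewrite subr_eq0; apply/eqP => e; have di := cartan_d_gt0 hC i.
have : q ^ (d i + d i)%N%:Z = 1.
  by rewrite -exprnP exprD -/(q_ d q i) [X in X * _]e mulVf // q_neq0.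
by move/expz_eq1; lia.
Qed.

(** The coefficient of omega_j in the sum of the b_i alpha_i, hence the exponent of q_j in the order
    on the torus. *)
Definition root_pairing (J : {set 'I_n}) (b : 'I_n -> nat) (j : 'I_n) : int :=
  \sum_(i in J) (b i)%:Z * C j i.

(** As q is not a root of unity, all exponents d_j [root_pairing J b j] vanish; pairing them with b
    gives the value of the symmetrized form at b, which is positive unless b = 0 on J. *)
Lemma root_pairing_inj (J : {set 'I_n}) (b : 'I_n -> nat) :
  (forall j, j \in J -> q_ d q j ^ root_pairing J b j = 1) ->
  forall i, i \in J -> b i = 0%N.
Proof.
move=> hb i iJ; apply/eqP/negPn/negP => bi0.
pose a k : rat := if k \in J then (b k)%:R else 0.
have : 0 < \sum_i \sum_j a i * ((d i)%:Z * C i j)%:~R * a j.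
  by apply: (cartan_posdef hC); exists i; rewrite /a iJ pnatr_eq0.
rewrite big1 ?ltxx // => k _; rewrite /a; case: ifP => [kJ|_]; last first.
  by apply: big1 => j _; rewrite !mul0r.
have hk : (d k)%:Z * root_pairing J b k = 0.
  by apply: expz_eq1; rewrite -exprz_exp -exprnP; apply: hb.
transitivity ((b k)%:R * ((d k)%:Z * root_pairing J b k)%:~R : rat); last first.
  by rewrite hk mulr0.
rewrite /root_pairing !mulr_sumr raddf_sum /= mulr_sumr [RHS]big_mkcond.
apply: eq_bigr => j _; case: ifP => _; last by rewrite mulr0.
by rewrite -mulrA !intrM; congr (_ * _); rewrite -mulrA; congr (_ * _); rewrite mulrC.
Qed.

End CartanNondegeneracy.

(** * Uniqueness of highest l-weight vectors *)

Section Modules.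
Variables (K : fieldType) (n : nat) (C : 'M[int]_n) (d : 'I_n -> nat) (q : K).
Hypotheses (char0 : forall k, k.+1%:R != 0 :> K).
Implicit Types (i j : 'I_n) (J : {set 'I_n}) (e : bool) (r s : int).
Implicit Types (nu : coweight n) (V : loop_module K n).

(** The m-th coefficient of the series g with phi_i^e(z) x_j^e'(w) = g(z/w) x_j^e'(w) phi_i^e(z):
    the power of q_i comes from the leading mode, the rest from the exponential of the h's. No datum
    of a module enters. *)
Definition phi_x_coef e e' i j (m : nat) : K :=
  q_ d q i ^ (pm e * (pm e' * C i j)) *
  \sum_(l < m.+1) (l`!%:R)^-1 * lam_pow (fun a : nat =>
    (pm e)%:~R * (q_ d q i - (q_ d q i)^-1) *
    ((pm e')%:~R * ((pm e * a%:Z)%:~R)^-1 *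
       qint (q_ d q i) (pm e * a%:Z * C i j))) l m.

Section OneModule.
Variables (J : {set 'I_n}) (nu : coweight n) (V : loop_module K n).
Hypothesis hV : is_module C d q J nu V.

Lemma phi_vanish e i r (v : V) : i \in J -> pm e * (r - lead nu e i) < 0 ->
  lm_phi V e i r v = 0.
Proof.
case: e => iJ; rewrite /pm /lead => hr.
  by apply: (phi_plus_lt0 hV) => //; lia.
by apply: (phi_minus_gt hV) => //; lia.
Qed.

Lemma phi_lead_x e e' i j s (v : V) : i \in J -> j \in J ->
  lm_phi V e i (lead nu e i) (lm_x V e' j s v) =
  q_ d q i ^ (pm e * (pm e' * C i j)) *:
    lm_x V e' j s (lm_phi V e i (lead nu e i) v).
Proof.
move=> iJ jJ; case: e; first by rewrite (phi_plus_x hV) // mul1r.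
by rewrite (phi_minus_x hV) // mulN1r.
Qed.

Lemma phi_x_comm e e' i j (r : nat) s (v : V) : i \in J -> j \in J ->
  lm_phi V e i (lead nu e i + pm e * r%:Z) (lm_x V e' j s v) =
  \sum_(m < r.+1) phi_x_coef e e' i j m *:
    lm_x V e' j (s + pm e * m%:Z)
      (lm_phi V e i (lead nu e i + pm e * (r - m)%N%:Z) v).
Proof.
move=> iJ jJ; have [h hspec hx] := h_x hV.
rewrite (hspec e i r _ iJ).
pose H (m : nat) (w : V) : V :=
  ((pm e)%:~R * (q_ d q i - (q_ d q i)^-1)) *: h i (pm e * m%:Z) w.
have linH m : linear (H m).
  by move=> a u w; rewrite /H linearP scalerDr !scalerA mulrC.
have linX t : linear (lm_x V e' j t) by move=> a u w; rewrite linearP.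
pose lam (a : nat) := (pm e)%:~R * (q_ d q i - (q_ d q i)^-1) *
    ((pm e')%:~R * ((pm e * a%:Z)%:~R)^-1 *
       qint (q_ d q i) (pm e * a%:Z * C i j)) : K.
have commHX m t w : H m.+1 (lm_x V e' j t w) =
    lm_x V e' j t (H m.+1 w) + lam m.+1 *: lm_x V e' j (t + pm e * m.+1%:Z) w.
  rewrite /H /lam linearZ /= -[X in _ = _ + X]scalerA -scalerDr; congr (_ *: _).
  rewrite [t + _]addrC -hx //; last by case: (e).
  by rewrite addrC subrK.
rewrite (exp_coef_comm char0 linH linX commHX) raddf_sum /=.
apply: eq_bigr => m _; rewrite linearZ /= phi_lead_x // scalerA.
by rewrite (hspec e i _ _ iJ) /phi_x_coef mulrC.
Qed.

End OneModule.

(* A weakening of hl_vector that does not refer to the rational functions Psi. *)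
Record sing_gen J nu V (v : V) : Prop := {
  sing_neq0 : v != 0;
  sing_x : forall j r, j \in J -> lm_x V true j r v = 0;
  sing_phi : forall e j r, j \in J -> line v (lm_phi V e j r v);
  sing_all : forall S : V -> Prop, submodule J nu S -> S v -> forall w, S w
}.

Lemma hl_sing_gen J nu V (v : V) :
  is_module C d q J nu V -> hl_vector J nu v -> sing_gen J nu v.
Proof.
move=> hV [v0 hx [Psi _ hPsi] hgen]; split=> // e j r jJ.
apply: (line_frac_mul (hPsi e j jJ) (N := lead nu e j)) => s.
exact: (phi_vanish hV).
Qed.

Section Weights.
Hypotheses (hC : simple_cartan C d) (q0 : q != 0).
Hypothesis q_not_root : forall k : nat, (0 < k)%N -> q ^+ k != 1.
Variables (J : {set 'I_n}) (nu : coweight n) (V : loop_module K n).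
Hypothesis hV : is_module C d q J nu V.

Lemma phi_lead_inj e i : i \in J -> injective (lm_phi V e i (lead nu e i)).
Proof. by move=> iJ; apply: bij_inj; apply: (phi_lead_inv hV). Qed.

Definition subspace (S : V -> Prop) : Prop :=
  S 0 /\ forall (a : K) v w, S v -> S w -> S (a *: v + w).

Lemma subspaceZ S a v : subspace S -> S v -> S (a *: v).
Proof. by move=> [S0 SP] Sv; rewrite -[_ *: _]addr0; apply: SP. Qed.

Lemma subspaceD S v w : subspace S -> S v -> S w -> S (v + w).
Proof. by move=> [S0 SP] Sv Sw; rewrite -[v]scale1r; apply: SP. Qed.

Lemma subspace_sum S (I : Type) (r : seq I) (P : pred I) (F : I -> V) :
  subspace S -> (forall k, P k -> S (F k)) -> S (\sum_(k <- r | P k) F k).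
Proof.
move=> hS hF; apply: (big_ind S) => //; first by case: hS.
by move=> u w; apply: subspaceD.
Qed.

Definition xminus_stable (S : V -> Prop) : Prop :=
  subspace S /\ forall j r v, j \in J -> S v -> S (lm_x V false j r v).

(** Triangular decomposition: the span X of the x^- words applied to w is stable under the phi by
    [phi_x_comm] and under x^+ by its commutator with x^-, so it is a submodule containing the
    generator. *)
Lemma xminus_span_all w : sing_gen J nu w ->
  forall S, xminus_stable S -> S w -> forall u, S u.
Proof.
move=> hw; pose X (u : V) := forall S, xminus_stable S -> S w -> S u.
have Xw : X w by [].
have X_sub : subspace X.
  split=> [S [[]]//|a u u' Xu Xu' S hS Sw].
  by case: (hS) => -[_ SP] _; apply: SP; [exact: Xu|exact: Xu'].
have X_xm j r u : j \in J -> X u -> X (lm_x V false j r u).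
  by move=> jJ Xu S hS Sw; apply: hS.2 => //; apply: Xu.
have X_line u : line w u -> X u by move=> [c ->]; apply: subspaceZ X_sub Xw.
(* Induction along the generation of X; in the x^- step, membership in X itself is also
   available. *)
have X_ind (S : V -> Prop) : (forall a v v', S v -> S v' -> S (a *: v + v')) ->
    S 0 -> (forall j r v, j \in J -> X v -> S v -> S (lm_x V false j r v)) ->
    S w -> forall u, X u -> S u.
  move=> SP S0 Sx Sw u Xu; have [] : X u /\ S u; last by [].
  apply: (Xu (fun u => X u /\ S u)) => //; split; last first.
    by move=> j r v jJ [Xv Sv]; split; [apply: X_xm | apply: Sx].
  split; first by split=> //; case: X_sub.
  by move=> a v v' [Xv Sv] [Xv' Sv']; split; [apply: X_sub.2 | apply: SP].
have X_phi e i r u : i \in J -> X u -> X (lm_phi V e i r u).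
  move=> iJ Xu; move: u Xu r; apply: X_ind => [a v v' hv hv' r|r|j s v jJ Xv hv r|r].
  - by rewrite linearP; apply: X_sub.2.
  - by rewrite linear0; case: X_sub.
  - have [lt_r|le_r] := ltP (pm e * (r - lead nu e i)) 0.
      by rewrite (phi_vanish hV) //; case: X_sub.
    have [m em] : exists m : nat, r = lead nu e i + pm e * m%:Z.
      exists (absz (pm e * (r - lead nu e i))).
      by move: le_r; case: (e); rewrite /pm; lia.
    rewrite em (phi_x_comm hV) //; apply: subspace_sum => [|l _]; first exact: X_sub.
    by apply: (subspaceZ _ X_sub); apply: X_xm => //; apply: hv.
  - by apply: X_line; apply: (sing_phi hw).
have X_xp i r u : i \in J -> X u -> X (lm_x V true i r u).
  move=> iJ Xu; move: u Xu; apply: X_ind => [a v v' hv hv'||j s v jJ Xv hv|].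
  - by rewrite linearP; apply: X_sub.2.
  - by rewrite linear0; case: X_sub.
  - have := x_plus_minus hV r s v iJ jJ.
    set y := (if _ then _ else _) => ey.
    have -> : lm_x V true i r (lm_x V false j s v) =
        (q_ d q i - (q_ d q i)^-1)^-1 *: y + lm_x V false j s (lm_x V true i r v).
      rewrite -ey scalerA mulVf ?scale1r ?subrK //.
      exact: (q_subV_neq0 hC).
    apply: X_sub.2; last exact: X_xm.
    rewrite /y; case: eqP => _; last by case: X_sub.
    by rewrite -scaleN1r addrC; apply: X_sub.2; apply: X_phi.
  - by rewrite (sing_x hw) //; case: X_sub.
(* Stability under inverses is shown as surjectivity of the leading mode on X; injectivity on V then
   identifies the preimage. *)
have X_inv e i u : i \in J -> X u -> exists2 u', X u' & lm_phi V e i (lead nu e i) u' = u.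
  move=> iJ Xu; move: u Xu.
  apply: X_ind => [a v v' [y Xy <-] [y' Xy' <-]||j s v jJ Xv [y Xy <-]|].
  - by exists (a *: y + y'); rewrite ?linearP //; apply: X_sub.2.
  - by exists 0; rewrite ?linear0 //; case: X_sub.
  - pose c := q_ d q i ^ (pm e * (pm false * C i j)).
    exists (c^-1 *: lm_x V false j s y).
      by apply: (subspaceZ _ X_sub); apply: X_xm.
    by rewrite linearZ /= (phi_lead_x hV) // scalerA mulVf ?scale1r //
      expfz_neq0 // (q_neq0 _ q0).
  - have [c hc] := sing_phi hw e (lead nu e i) iJ.
    have c0 : c != 0.
      apply: contra (sing_neq0 hw) => /eqP c0; apply/eqP.
      by apply: (phi_lead_inj (e := e) iJ); rewrite hc c0 scale0r linear0.
    exists (c^-1 *: w); first exact: subspaceZ X_sub Xw.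
    by rewrite linearZ /= hc scalerA mulVf // scale1r.
move=> S hS Sw u; suff : X u by apply.
apply: (sing_all hw) => //; split.
- by case: X_sub.
- exact: X_sub.2.
- by case=> i r v; [exact: X_xp | exact: X_xm].
- exact: X_phi.
- move=> e i v iJ /(X_inv e i _ iJ)[v' Xv' ev].
  by rewrite -(phi_lead_inj iJ ev).
Qed.

Definition wt (g : 'I_n -> K) (u : V) : Prop :=
  forall i, i \in J -> lm_phi V true i 0 u = g i *: u.

Lemma wtZ g a u : wt g u -> wt g (a *: u).
Proof. by move=> hu i iJ; rewrite linearZ /= hu // !scalerA mulrC. Qed.

(** Independence of eigenspaces: if g p and g' differ at j, then phi_(j, 0)^+ - g_p(j) kills u p,
    multiplies w by a nonzero scalar and only rescales the other terms. *)
Lemma wt_bad_sum (I : eqType) (ps : seq I) (g : I -> 'I_n -> K) (u : I -> V)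
    (g' : 'I_n -> K) (w : V) :
  {in ps, forall p, wt (g p) (u p)} ->
  {in ps, forall p, ~~ [forall j in J, g p j == g' j]} ->
  wt g' w -> w = \sum_(p <- ps) u p -> w = 0.
Proof.
elim: ps u w => [|p ps IHps] u w hu hg hw ew; first by rewrite ew big_nil.
have := hg p (mem_head _ _); rewrite negb_forall_in => /exists_inP[j jJ gj].
have dj : g' j - g p j != 0 by rewrite subr_eq0 eq_sym.
suff : (g' j - g p j) *: w = 0 by move/eqP; rewrite scaler_eq0 (negPf dj) => /eqP.
have mem_ps p' : p' \in ps -> p' \in p :: ps by rewrite inE orbC => ->.
apply: (IHps (fun p' => (g p' j - g p j) *: u p')).
- by move=> p' /mem_ps p'in; apply: wtZ; apply: hu.
- by move=> p' /mem_ps; apply: hg.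
- exact: wtZ.
rewrite scalerBl -hw // {1}ew raddf_sum /= ew scaler_sumr !big_cons.
rewrite hu ?mem_head // opprD addrACA subrr add0r -sumrB.
by apply: eq_big_seq => p' /mem_ps /hu -> //; rewrite scalerBl.
Qed.

Lemma wt_proj (I : eqType) (ps : seq I) (g : I -> 'I_n -> K) (u : I -> V)
    (g' : 'I_n -> K) (w : V) :
  {in ps, forall p, wt (g p) (u p)} -> wt g' w -> w = \sum_(p <- ps) u p ->
  w = \sum_(p <- ps | [forall j in J, g p j == g' j]) u p.
Proof.
move=> hu hw ew; pose good p := [forall j in J, g p j == g' j].
apply/eqP; rewrite -subr_eq0; apply/eqP.
apply: (@wt_bad_sum _ [seq p <- ps | ~~ good p] g u g').
- by move=> p; rewrite mem_filter => /andP[_ /hu].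
- by move=> p; rewrite mem_filter => /andP[].
- move=> j jJ; rewrite raddfB /= hw // scalerBr; congr (_ - _).
  rewrite raddf_sum scaler_sumr big_seq_cond [RHS]big_seq_cond /=.
  apply: eq_bigr => p /andP[pin /forall_inP /(_ j jJ)/eqP <-].
  by rewrite hu.
by rewrite big_filter [X in X - _]ew (bigID good) /= addrAC subrr add0r.
Qed.

(** The weight g lowered by the sum over J of the b_i alpha_i. *)
Definition sub_wt (g : 'I_n -> K) (b : {ffun 'I_n -> nat}) j : K :=
  g j * q_ d q j ^ (- root_pairing C J b j).

(** Each x_k^- lowers weights by alpha_k, so everything outside the line of w lies in strictly lower
    weights. *)
Lemma lower_weights w g : wt g w -> sing_gen J nu w -> forall u,
  exists a (ps : seq ({ffun 'I_n -> nat} * V)), u = a *: w + \sum_(p <- ps) p.2 /\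
  {in ps, forall p, wt (sub_wt g p.1) p.2 /\ exists2 i, i \in J & p.1 i != 0%N}.
Proof.
move=> hg hw; apply: (xminus_span_all hw); last first.
  by exists 1, [::]; rewrite big_nil scale1r addr0.
split.
  split; first by exists 0, [::]; rewrite big_nil scale0r addr0.
  move=> a u u' [c [ps [-> hps]]] [c' [ps' [-> hps']]].
  exists (a * c + c'), ([seq (p.1, a *: p.2) | p <- ps] ++ ps'); split.
    by rewrite big_cat big_map /= -scaler_sumr scalerDr scalerDl scalerA addrACA.
  move=> p; rewrite mem_cat => /orP[/mapP[p' /hps[h1 h2] ->]|/hps' //].
  by split=> //; apply: wtZ.
move=> k r u kJ [c [ps [-> hps]]].
pose up (b : {ffun 'I_n -> nat}) := [ffun i => (b i + (i == k))%N].
have wt_up b v : wt (sub_wt g b) v -> wt (sub_wt g (up b)) (lm_x V false k r v).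
  move=> hv j jJ; have := phi_lead_x hV true false r v jJ kJ.
  rewrite /lead => ->; rewrite hv // linearZ scalerA; congr (_ *: _).
  rewrite /sub_wt mulrCA; congr (_ * _).
  rewrite -expfzDr ?q_neq0 //; congr (_ ^ _).
  rewrite /root_pairing (bigD1 k) //= [in RHS](bigD1 k) //= ffunE eqxx.
  under [in RHS]eq_bigr => l /andP[_ /negPf lk] do rewrite ffunE lk addn0.
  rewrite /pm mul1r mulN1r (_ : (b k + true)%N%:Z = (b k)%:Z + 1) // mulrDl mul1r.
  by rewrite !opprD addrA (addrC (- C j k)).
have up_k b : up b k != 0%N by rewrite ffunE eqxx addn1.
exists 0, ((up [ffun=> 0%N], c *: lm_x V false k r w) ::
  [seq (up p.1, lm_x V false k r p.2) | p <- ps]); split.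
  by rewrite big_cons big_map scale0r add0r linearP raddf_sum.
move=> p; rewrite inE => /orP[/eqP ->|/mapP[p' /hps[h1 h2] ->]] /=.
  split; last by exists k.
  apply: wtZ; apply: wt_up => j jJ; rewrite hg //; congr (_ *: _).
  rewrite /sub_wt /root_pairing big1 ?oppr0 ?expr0z ?mulr1 // => l _.
  by rewrite ffunE mul0r.
by split; [apply: wt_up | exists k].
Qed.

Lemma sing_gen_wt (w : V) : sing_gen J nu w ->
  exists2 g, wt g w & forall j, j \in J -> g j != 0.
Proof.
move=> hw; have [g hg] : exists g : 'I_n -> K, wt g w.
  suff /choice[g hg] : forall j, exists c, j \in J -> lm_phi V true j 0 w = c *: w.
    by exists g.
  move=> j; have [jJ|_] := boolP (j \in J); last by exists 0.
  by have [c hc] := sing_phi hw true 0 jJ; exists c.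
exists g => // j jJ; apply: contra (sing_neq0 hw) => /eqP gj0; apply/eqP.
by apply: (phi_lead_inj (e := true) jJ); rewrite /lead hg // gj0 scale0r linear0.
Qed.

Lemma sing_gen_unique (w w' : V) : sing_gen J nu w -> sing_gen J nu w' ->
  exists2 a, a != 0 & w' = a *: w.
Proof.
move=> hw hw'; have [g hg gN0] := sing_gen_wt hw; have [g' hg' g'N0] := sing_gen_wt hw'.
have zero_sub (b : {ffun 'I_n -> nat}) (h : 'I_n -> K) j :
    {in J, b =1 fun=> 0%N} -> sub_wt h b j = h j.
  move=> b0; rewrite /sub_wt /root_pairing big1 ?oppr0 ?expr0z ?mulr1 // => i iJ.
  by rewrite b0 // mul0r.
have expand (v v' : V) h h' : sing_gen J nu v -> sing_gen J nu v' -> wt h v -> wt h' v' ->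
    exists a (ps : seq ({ffun 'I_n -> nat} * V)),
    [/\ v' = \sum_(p <- ([ffun=> 0%N], a *: v) :: ps |
                [forall j in J, sub_wt h p.1 j == h' j]) p.2,
        v' = a *: v + \sum_(p <- ps) p.2
      & {in ps, forall p : {ffun 'I_n -> nat} * V, exists2 i, i \in J & p.1 i != 0%N}].
  move=> hv hv' wv wv'; have [a [ps [ev' hps]]] := lower_weights wv hv v'.
  exists a, ps; split=> //; last by move=> p /hps[].
  apply: (@wt_proj _ _ (fun p => sub_wt h p.1) (fun p => p.2)) => //.
    move=> p; rewrite inE => /orP[/eqP ->|/hps[] //] /=.
    apply: wtZ => j jJ; rewrite zero_sub; first exact: wv.
    by move=> i _; rewrite ffunE.
  by rewrite big_cons.
(* Since v' is nonzero, some term of its expansion must have the weight of v', which is therefore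
   lower than or equal to that of v. *)
have expand_wt (v v' : V) h h' :
    sing_gen J nu v -> sing_gen J nu v' -> wt h v -> wt h' v' ->
    exists b, forall j, j \in J -> h' j = sub_wt h b j.
  move=> hv hv' wv wv'; have [a [ps [ev' _ _]]] := expand _ _ _ _ hv hv' wv wv'.
  have : has (fun p : _ * V => [forall j in J, sub_wt h p.1 j == h' j])
             (([ffun=> 0%N], a *: v) :: ps).
    apply: contraT => /hasPn hno; have := sing_neq0 hv'.
    by rewrite ev' big_seq_cond big1 ?eqxx // => p /andP[/hno/negPf ->].
  case/hasP=> p _ /forall_inP hp; exists p.1 => j jJ.
  by apply/esym/eqP/hp.
have [b hb] := expand_wt _ _ _ _ hw hw' hg hg'.
have [b' hb'] := expand_wt _ _ _ _ hw' hw hg' hg.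
(* Lowering g by b and then by b' returns to g, so b + b' pairs trivially with all of J. *)
have bb0 : forall i, i \in J -> (b i + b' i)%N = 0%N.
  apply: (root_pairing_inj hC q_not_root (b := fun i => (b i + b' i)%N)) => j jJ.
  have : g j = g j * (q_ d q j ^ (- root_pairing C J b j) *
                      q_ d q j ^ (- root_pairing C J b' j)).
    by rewrite {1}hb' // /sub_wt hb // /sub_wt -mulrA.
  rewrite -{1}[g j]mulr1 => /(mulfI (gN0 j jJ)).
  rewrite -expfzDr ?q_neq0 // -opprD -big_split /=.
  under eq_bigr do rewrite -mulrDl -PoszD.
  rewrite -/(root_pairing C J (fun i => (b i + b' i)%N) j) => e.
  by apply: invr_inj; rewrite invr_expz -e invr1.
have b0 : {in J, b =1 fun=> 0%N} by move=> i /bb0 /eqP; rewrite addn_eq0 => /andP[/eqP].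
have egg' j : j \in J -> g' j = g j by move=> jJ; rewrite hb // zero_sub.
(* Now w and w' have the same weight, and no strictly lower term can contribute to it: only the
   multiple of w survives. *)
have [a [ps [e1 _ hps]]] := expand _ _ _ _ hw hw' hg hg'.
have ew' : w' = a *: w.
  rewrite e1 big_cons; have -> : [forall j in J, sub_wt g [ffun=> 0%N] j == g' j].
    by apply/forall_inP => j jJ; rewrite zero_sub ?egg' // => i _; rewrite ffunE.
  rewrite big_seq_cond big1 ?addr0 // => p /andP[/hps[i iJ pi0] /forall_inP hp].
  case/eqP: pi0; apply: (root_pairing_inj hC q_not_root (J := J)) iJ => j jJ.
  have /eqP := hp j jJ; rewrite /sub_wt egg' // -[RHS]mulr1 => /(mulfI (gN0 j jJ)) e.
  by apply: invr_inj; rewrite invr_expz e invr1.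
exists a => //; apply: contra (sing_neq0 hw') => /eqP a0.
by rewrite ew' a0 scale0r.
Qed.

End Weights.

End Modules.

(** * Quasi-commuting families *)

Lemma linear_inverse (K : fieldType) (U W : lmodType K) (f : {linear U -> W}) :
  bijective f -> exists2 f' : {linear W -> U}, cancel f f' & cancel f' f.
Proof.
case=> f' fK f'K; have lf' : linear f'.
  by move=> a u w; apply: (can_inj fK); rewrite linearP !f'K.
pose F' : {linear W -> U} := HB.pack f' (GRing.isLinear.Build K W U *:%R f' lf').
by exists F'.
Qed.

Section Dirac.
Variables (K : fieldType) (V : lmodType K).

(** The identity as a constant current. It lets the summands x_i^+(z) (x) 1 and 1 (x) x_i^-(zu) be
    treated as instances of [conv]. *)
Definition dirac (t : int) : {linear V -> V} :=
  if t == 0 then (idfun : {linear V -> V}) else (\0%R : {linear V -> V}).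

Lemma dirac0 t v : t != 0 -> dirac t v = 0.
Proof. by rewrite /dirac => /negPf ->. Qed.

End Dirac.

Section Families.
Variables (K : fieldType) (V : lmodType K).
Implicit Types (f a b : int -> {linear V -> V}) (g : nat -> K).

(** The mode form of f(z) a(w) = g(z/w) a(w) f(z). For f without negative modes the terms with m > r
    vanish, so any M > r will do. *)
Definition shift_comm g f a : Prop := forall (r s : int) (M : nat) v,
  r < M%:Z -> f r (a s v) = \sum_(m < M) g m *: a (s + m%:Z) (f (r - m%:Z) v).

Definition commuting f b : Prop := forall (r s : int) v, f r (b s v) = b s (f r v).

Definition nonneg_family f : Prop := forall (r : int) v, r < 0 -> f r v = 0.

Lemma dirac_commuting f : commuting f (dirac V).
Proof. by move=> r s v; rewrite /dirac; case: ifP => // _ /=; rewrite linear0. Qed.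

End Families.

Section ConvCommutation.
Variables (K : fieldType) (V1 V2 : lmodType K).
Variables (f1 : int -> {linear V1 -> V1}) (f2 : int -> {linear V2 -> V2}).
Hypotheses (f1_ge0 : nonneg_family f1) (f2_ge0 : nonneg_family f2).
Variables (a : int -> {linear V1 -> V1}) (b : int -> {linear V2 -> V2}).
Hypothesis ab_lb : lower_bounded a b.
Variable g : nat -> K.
Local Notation T := (tensor V1 V2).

Lemma nonneg_lower_bounded : lower_bounded f1 f2.
Proof. by move=> r; exists 0 => t x /f2_ge0 h; apply: tens0r. Qed.

Lemma nonneg_upper_bounded : upper_bounded f1 f2.
Proof. by move=> r; exists r => t x ht; apply: tens0l => v; apply: f1_ge0; lia. Qed.

(** Here the scalar series arises on the first factor, in [conv_commR] on the second; the resulting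
    relation on the tensor product is the same. *)
Lemma conv_commL (r s : int) (M : nat) (f : int -> T) k :
  shift_comm g f1 a -> commuting f2 b -> r < M%:Z -> laurent f ->
  conv f1 f2 r (conv a b s f) k =
  \sum_(m < M) g m *: conv a b (s + m%:Z) (conv f1 f2 (r - m%:Z) f) k.
Proof.
move=> f1a f2b lt_rM hf.
apply: (conv_comm ab_lb nonneg_lower_bounded nonneg_upper_bounded
  (sh := fun=> 0)) => // t p x.
have [t_lt0|t_ge0] := ltP t 0.
  rewrite tens0r => [|w]; last exact: f2_ge0.
  rewrite big1 // => m _; rewrite [tens _ _ x]tens0r => [|w].
    by rewrite (linear_fun0 (tens_linear _ _)) scaler0.
  by apply: f2_ge0; lia.
pose F (m : 'I_M) (v : V1) := a (s - p + m%:Z) (f1 (r - t - m%:Z) v).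
rewrite tens_comp
  (@tens_suml _ _ _ _ _ _ (index_enum 'I_M) (fun m : 'I_M => g m) F) => [|v].
  apply: eq_bigr => m _; rewrite tens_comp addr0 subr0.
  rewrite (addrAC s) (addrAC r); congr (_ *: _).
  by apply: eq_tens => // w /=; rewrite f2b.
by apply: f1a; lia.
Qed.

Lemma conv_commR (r s : int) (M : nat) (f : int -> T) k :
  commuting f1 a -> shift_comm g f2 b -> r < M%:Z -> laurent f ->
  conv f1 f2 r (conv a b s f) k =
  \sum_(m < M) g m *: conv a b (s + m%:Z) (conv f1 f2 (r - m%:Z) f) k.
Proof.
move=> f1a f2b lt_rM hf.
apply: (conv_comm ab_lb nonneg_lower_bounded nonneg_upper_bounded
  (sh := fun m => - m%:Z)) => // t p x.
have [lt_rt|le_tr] := ltP r t.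
  rewrite tens0l => [|w]; last by apply: f1_ge0; lia.
  rewrite big1 // => m _; rewrite [tens _ _ x]tens0l => [|w].
    by rewrite (linear_fun0 (tens_linear _ _)) scaler0.
  by apply: f1_ge0; lia.
pose F (m : 'I_M) (w : V2) := b (p + m%:Z) (f2 (t - m%:Z) w).
rewrite tens_comp
  (@tens_sumr _ _ _ _ _ _ (index_enum 'I_M) (fun m : 'I_M => g m) _ F) => [|w].
  apply: eq_bigr => m _; rewrite tens_comp opprK.
  have -> : s + m%:Z - (p + m%:Z) = s - p by lia.
  have -> : r - m%:Z - (t - m%:Z) = r - t by lia.
  by congr (_ *: _); apply: eq_tens => // v /=; rewrite f1a.
by apply: f2b; lia.
Qed.

Lemma conv_commC (r s : int) (f : int -> T) k :
  commuting f1 a -> commuting f2 b -> laurent f ->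
  conv f1 f2 r (conv a b s f) k = conv a b s (conv f1 f2 r f) k.
Proof.
move=> f1a f2b hf.
rewrite (conv_comm ab_lb nonneg_lower_bounded nonneg_upper_bounded
  (sh := fun=> 0) (M := 1) (g := fun=> 1)) // => [|t p x]; last first.
  rewrite big_ord1 scale1r !tens_comp.
  have -> : s + Posz (ord0 : 'I_1) - (p - 0) = s - p by move=> /=; lia.
  have -> : r - Posz (ord0 : 'I_1) - (t + 0) = r - t by move=> /=; lia.
  have -> : p - 0 = p by lia.
  have -> : t + 0 = t by lia.
  by apply: eq_tens => u /=.
rewrite big_ord1 scale1r; have -> : s + Posz (ord0 : 'I_1) = s by move=> /=; lia.
by have -> : r - Posz (ord0 : 'I_1) = r by move=> /=; lia.
Qed.

End ConvCommutation.

(** * Lattices in the tensor product *)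

Section Lattices.
Variables (K : fieldType) (n : nat) (C : 'M[int]_n) (d : 'I_n -> nat) (q : K).
Implicit Types (i j : 'I_n) (J : {set 'I_n}) (e : bool) (r s : int).
Implicit Types (nu mu : coweight n) (V : loop_module K n).

Section Delta.
Variables (V1 V2 : loop_module K n).
Implicit Types (f : int -> tensor V1 V2).

Lemma Delta_phiE e i r f :
  Delta_phi e i r f = conv (lm_phi V1 e i) (lm_phi V2 e i) r f.
Proof. by []. Qed.

Lemma Delta_x_plusE i r f : Delta_x true i r f = fun k =>
  conv (lm_x V1 true i) (dirac V2) r f k +
  conv (lm_phi V1 false i) (lm_x V2 true i) r f k.
Proof.
apply: funext => k; congr (_ + _).
rewrite /conv (fsum1 (c := 0)) ?subr0 // => t t0.
by apply: tens0r => w; apply: dirac0.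
Qed.

Lemma Delta_x_minusE i r f : Delta_x false i r f = fun k =>
  conv (dirac V1) (lm_x V2 false i) r f k +
  conv (lm_x V1 false i) (lm_phi V2 true i) r f k.
Proof.
apply: funext => k; congr (_ + _).
rewrite /conv (fsum1 (c := r)) ?subrr // => t tr.
by apply: tens0l => v; apply: dirac0; rewrite subr_eq0 eq_sym.
Qed.

Variables (J : {set 'I_n}) (nu1 nu2 : coweight n).
Hypotheses (hV1 : is_module C d q J nu1 V1) (hV2 : is_module C d q J nu2 V2).

Lemma phi_phi_bounded e i : i \in J -> lower_bounded (lm_phi V1 e i) (lm_phi V2 e i).
Proof.
move=> iJ r; case: e.
  exists 0 => t x t0; apply: tens0r => w.
  by apply: (phi_vanish hV2); rewrite // /pm /lead; lia.
exists (r - nu1 i) => t x t0; apply: tens0l => w.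
by apply: (phi_vanish hV1); rewrite // /pm /lead; lia.
Qed.

Lemma x_dirac_bounded e i : lower_bounded (lm_x V1 e i) (dirac V2).
Proof.
by move=> r; exists 0 => t x t0; apply: tens0r => w; apply: dirac0; lia.
Qed.

Lemma phi_x_bounded e i : i \in J -> lower_bounded (lm_phi V1 false i) (lm_x V2 e i).
Proof.
move=> iJ r; exists (r - nu1 i) => t x t0; apply: tens0l => w.
by apply: (phi_vanish hV1); rewrite // /pm /lead; lia.
Qed.

Lemma dirac_x_bounded e i : lower_bounded (dirac V1) (lm_x V2 e i).
Proof.
by move=> r; exists r => t x t0; apply: tens0l => w; apply: dirac0; lia.
Qed.

Lemma x_phi_bounded e i : i \in J -> lower_bounded (lm_x V1 e i) (lm_phi V2 true i).
Proof.
move=> iJ r; exists 0 => t x t0; apply: tens0r => w.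
by apply: (phi_vanish hV2); rewrite // /pm /lead; lia.
Qed.

End Delta.

Section SerSubmodules.
Variables (V1 V2 : loop_module K n) (J : {set 'I_n}) (nu : coweight n).
Variable S : (int -> tensor V1 V2) -> Prop.
Hypothesis hS : ser_submodule J nu S.
Implicit Types (f : int -> tensor V1 V2).

Lemma ser_laurent f : S f -> laurent f.
Proof. by move=> /(ser_rational hS)[]. Qed.

Lemma regular_polyC c : regular_at 1 (tofrac (c%:P : {poly K})).
Proof. by exists c%:P, 1; rewrite hornerC oner_neq0 rmorph1 divr1. Qed.

(** The shift is multiplication by u^c, and u is invertible in the ring of rational functions
    regular at u = 1. *)
Lemma ser_shift (c : int) f : S f -> S (fun k => f (k - c)).
Proof.
move=> Sf; have [N fN] := ser_laurent Sf.
have [a [b ec]] : exists a b : nat, c = a%:Z - b%:Z.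
  by case: c => m; [exists m, 0%N | exists 0%N, m.+1]; lia.
apply: (ser_scale hS (F := tofrac ('X^a : {poly K}) / tofrac ('X^b)) _ Sf).
- by exists 'X^a, 'X^b; rewrite hornerXn expr1n oner_neq0.
- by exists (N + c) => k hk; apply: fN; lia.
exists 'X^a, 'X^b; split=> //; first by rewrite -size_poly_eq0 size_polyXn.
by apply: funext => k; rewrite !pmul_serX; congr f; lia.
Qed.

Lemma ser_scalar c f : S f -> S (fun k => c *: f k).
Proof.
move=> Sf; have [N fN] := ser_laurent Sf.
apply: (ser_scale hS (regular_polyC c) Sf).
  by exists N => k /fN ->; rewrite scaler0.
exists c%:P, 1; split; rewrite ?oner_neq0 ?rmorph1 ?divr1 //.
by apply: funext => k; rewrite !pmul_serC scale1r.
Qed.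

Lemma ser_comb (I : Type) (t : seq I) (c : I -> K) (f : I -> int -> tensor V1 V2) :
  (forall m, S (f m)) -> S (fun k => \sum_(m <- t) c m *: f m k).
Proof.
move=> hf; elim: t => [|m t IHt].
  rewrite (_ : (fun _ => _) = fun=> 0); first exact: (ser_zero hS).
  by apply: funext => k; rewrite big_nil.
rewrite (_ : (fun _ => _) = fun k => c m *: f m k + \sum_(p <- t) c p *: f p k).
  by apply: (ser_add hS) => //; apply: ser_scalar.
by apply: funext => k; rewrite big_cons.
Qed.

End SerSubmodules.

(** An intersection of stable lattices is stable, but its elements are known to be rational only if
    the family is nonempty. *)
Lemma fusion_lattice_submodule V1 V2 J nu (v1 : V1) (v2 : V2) :
  (exists S, ser_submodule J nu S /\ S (cst_ser (pure v1 v2))) ->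
  ser_submodule J nu (fusion_lattice J nu v1 v2).
Proof.
case=> S0 [hS0 S0v]; split.
- by move=> f Xf; apply: (ser_rational hS0); apply: Xf.
- by move=> S hS _; apply: (ser_zero hS).
- by move=> f g Xf Xg S hS Sv; apply: (ser_add hS); [apply: Xf | apply: Xg].
- move=> F f g hF Xf hg hFfg S hS Sv; apply: (ser_scale hS hF _ hg hFfg).
  exact: Xf.
- by move=> e i r f iJ Xf S hS Sv; apply: (ser_x hS) => //; apply: Xf.
- by move=> e i r f iJ Xf S hS Sv; apply: (ser_phi hS) => //; apply: Xf.
- move=> e i f iJ hf Xf S hS Sv; apply: (ser_phi_inv hS (e := e) iJ hf).
  exact: Xf.
Qed.

(* Such families quasi-commute with the currents x_j(z), up to the same scalar *)
(* series on both tensor factors.                                              *)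
Record diag_family J V (v : V) (g : bool -> 'I_n -> nat -> K)
    (f : int -> {linear V -> V}) : Prop := {
  df_ge0 : nonneg_family f;
  df_x : forall e j, j \in J -> shift_comm (g e j) f (lm_x V e j);
  df_phi : forall e j, j \in J -> commuting f (lm_phi V e j);
  df_line : forall r, line v (f r v)
}.

(** The vectors of S that all modes of f keep in S form a submodule, by quasi-commutation, and it
    contains v because the modes act on v by scalars. *)
Lemma diag_submodule J nu V (v : V) g f :
  diag_family J v g f ->
  forall r u, (forall S : V -> Prop, submodule J nu S -> S v -> S u) ->
  forall S : V -> Prop, submodule J nu S -> S v -> S (f r u).
Proof.
move=> hf r u Xu S hS Sv.
have SZ a w : S w -> S (a *: w).
  by move=> Sw; rewrite -[_ *: _]addr0; apply: (sub_lin hS) => //; apply: (sub_zero hS).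
pose S' w := S w /\ forall r, S (f r w).
suff [] : S' u by move=> _; apply.
apply: Xu; last by split=> // r'; have [c ->] := df_line hf r'; apply: SZ.
split.
- by split=> [|r']; rewrite ?linear0; apply: (sub_zero hS).
- move=> a w w' [Sw Sfw] [Sw' Sfw']; split=> [|r']; rewrite ?linearP;
  exact: (sub_lin hS).
- move=> e j s w jJ [Sw Sfw]; split=> [|r']; first exact: (sub_x hS).
  have lt_r' : r' < (absz r').+1%:Z by lia.
  rewrite (df_x hf e jJ _ _ lt_r').
  apply: (big_ind S); [exact: (sub_zero hS)| |].
    by move=> w1 w2 Sw1 Sw2; rewrite -[w1]scale1r; apply: (sub_lin hS).
  by move=> m _; apply: SZ; apply: (sub_x hS).
- move=> e j s w jJ [Sw Sfw]; split=> [|r']; first exact: (sub_phi hS).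
  by rewrite (df_phi hf) //; apply: (sub_phi hS).
- move=> e j w jJ [Sw Sfw]; split=> [|r']; first exact: (sub_phi_inv hS jJ Sw).
  by apply: (sub_phi_inv hS (e := e) jJ); rewrite -(df_phi hf).
Qed.

Section DiagLattice.
Variables (V1 V2 : loop_module K n) (J : {set 'I_n}) (nu1 nu2 : coweight n).
Hypotheses (hV1 : is_module C d q J nu1 V1) (hV2 : is_module C d q J nu2 V2).
Variables (v1 : V1) (v2 : V2) (g : bool -> 'I_n -> nat -> K).
Variables (f1 : int -> {linear V1 -> V1}) (f2 : int -> {linear V2 -> V2}).
Hypotheses (hf1 : diag_family J v1 g f1) (hf2 : diag_family J v2 g f2).
Implicit Types (f : int -> tensor V1 V2).

Let f12_lb : lower_bounded f1 f2 := nonneg_lower_bounded f1 (df_ge0 hf2).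
Let f12_ub : upper_bounded f1 f2 := nonneg_upper_bounded f2 (df_ge0 hf1).

(** In each summand of the coproduct one tensor factor is an x_j, which produces g, and the other is
    a phi or the identity, which commutes. Both summands thus acquire the same series. *)
Lemma diag_Delta_x e j (r s : int) (M : nat) f : j \in J -> r < M%:Z -> laurent f ->
  conv f1 f2 r (Delta_x e j s f) =
  fun k => \sum_(m < M) g e j m *: Delta_x e j (s + m%:Z) (conv f1 f2 (r - m%:Z) f) k.
Proof.
move=> jJ lt_rM hf; apply: funext => k; case: e.
  rewrite Delta_x_plusE; under eq_bigr do rewrite Delta_x_plusE scalerDr.
  rewrite big_split -(conv_commL (df_ge0 hf1) (df_ge0 hf2) _ _ _ (df_x hf1 true jJ)) //=;
    [|exact: x_dirac_bounded|exact: dirac_commuting].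
  rewrite -(conv_commR (df_ge0 hf1) (df_ge0 hf2) _ _ _ (df_phi hf1 false jJ)
    (df_x hf2 true jJ)) //=; last exact: (phi_x_bounded _ hV1).
  rewrite -[X in _ = X + _]scale1r -(conv_lin f12_lb).
  - by congr conv; apply: funext => k'; rewrite scale1r.
  - by apply: conv_laurent => //; apply: x_dirac_bounded.
  - by apply: conv_laurent => //; apply: (phi_x_bounded _ hV1).
rewrite Delta_x_minusE; under eq_bigr do rewrite Delta_x_minusE scalerDr.
rewrite big_split -(conv_commR (df_ge0 hf1) (df_ge0 hf2) _ _ _ _
    (df_x hf2 false jJ)) //=; [|exact: dirac_x_bounded|exact: dirac_commuting].
rewrite -(conv_commL (df_ge0 hf1) (df_ge0 hf2) _ _ _ (df_x hf1 false jJ)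
    (df_phi hf2 true jJ)) //=; last exact: (x_phi_bounded _ hV2).
rewrite -[X in _ = X + _]scale1r -(conv_lin f12_lb).
- by congr conv; apply: funext => k'; rewrite scale1r.
- by apply: conv_laurent => //; apply: dirac_x_bounded.
- by apply: conv_laurent => //; apply: (x_phi_bounded _ hV2).
Qed.

Lemma diag_Delta_phi e j (r s : int) f : j \in J -> laurent f ->
  conv f1 f2 r (Delta_phi e j s f) = Delta_phi e j s (conv f1 f2 r f).
Proof.
move=> jJ hf; apply: funext => k.
apply: (conv_commC (df_ge0 hf1) (df_ge0 hf2)) => //.
- exact: (phi_phi_bounded hV1 hV2).
- exact: (df_phi hf1).
- exact: (df_phi hf2).
Qed.

Lemma diag_lattice nu (r : int) f :
  ser_submodule J nu (fusion_lattice J nu v1 v2) ->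
  fusion_lattice J nu v1 v2 f -> fusion_lattice J nu v1 v2 (conv f1 f2 r f).
Proof.
set X := fusion_lattice J nu v1 v2 => hX Xf.
have Xcst : X (cst_ser (pure v1 v2)) by [].
(* It suffices that this part of X is itself a stable lattice containing the generator. *)
pose S h := X h /\ forall r, X (conv f1 f2 r h).
suff : S f by case.
apply: Xf; last first.
  split=> // r'.
  have [c1 hc1] := choice (df_line hf1); have [c2 hc2] := choice (df_line hf2).
  pose Z (l : nat) (k : int) := cst_ser (pure v1 v2) (k - l%:Z).
  (* The modes act on v1 and v2 by scalars and only 0 <= t <= r' contributes, so the generator is
     multiplied by a polynomial in u. *)
  have -> : conv f1 f2 r' (cst_ser (pure v1 v2)) =
      fun k => \sum_(l <- iota 0 (absz r').+1) (c1 (r' - l%:Z) * c2 l%:Z) *: Z l k.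
    apply: funext => k.
    rewrite /conv (fsumE (s := [seq l%:Z | l <- iota 0 (absz r').+1])).
    - rewrite big_map; apply: eq_bigr => j _; rewrite /Z /cst_ser.
      case: ifP => _; last by rewrite (linear_fun0 (tens_linear _ _)) scaler0.
      by rewrite tens_pure hc1 hc2 pureZl pureZr scalerA.
    - by rewrite map_inj_uniq ?iota_uniq // => j j' [].
    move=> t tN; have [t0|t0] := ltP t 0.
      by apply: tens0r => w; apply: (df_ge0 hf2).
    apply: tens0l => w; apply: (df_ge0 hf1); rewrite ltNge; apply: contra tN => ?.
    by apply/mapP; exists (absz t); rewrite ?mem_iota; lia.
  by apply: (ser_comb hX) => j; apply: (ser_shift hX).
split.
- by move=> h [Xh _]; apply: (ser_rational hX).
- split; first exact: (ser_zero hX).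
  by move=> r'; rewrite conv0; apply: (ser_zero hX).
- move=> h h' [Xh Xfh] [Xh' Xfh']; split=> [|r']; first exact: (ser_add hX).
  have := conv_lin f12_lb 1 r' ^~ (ser_laurent hX Xh) => /(_ _ _ (ser_laurent hX Xh')) e.
  rewrite (_ : conv _ _ _ _ = fun k => conv f1 f2 r' h k + conv f1 f2 r' h' k).
    exact: (ser_add hX).
  apply: funext => k; rewrite -[X in X + _]scale1r -e.
  by congr conv; apply: funext => k'; rewrite scale1r.
- move=> F h h' hF [Xh Xfh] hh' hFhh'; split=> [|r'].
    exact: (ser_scale hX hF Xh hh' hFhh').
  apply: (ser_scale hX hF (Xfh r')); first exact: conv_laurent.
  by apply: conv_frac => //; apply: (ser_laurent hX Xh).
- move=> e j s h jJ [Xh Xfh]; split=> [|r']; first exact: (ser_x hX).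
  have lt_r' : r' < (absz r').+1%:Z by lia.
  rewrite (diag_Delta_x _ _ jJ lt_r' (ser_laurent hX Xh)).
  by apply: (ser_comb hX) => m; apply: (ser_x hX).
- move=> e j s h jJ [Xh Xfh]; split=> [|r']; first exact: (ser_phi hX).
  by rewrite diag_Delta_phi //; [apply: (ser_phi hX)|exact: (ser_laurent hX Xh)].
- move=> e j h jJ rat_h [Xh Xfh]; split=> [|r'].
    exact: (ser_phi_inv hX jJ rat_h Xh).
  apply: (ser_phi_inv hX (e := e) jJ); first exact: conv_rational.
  by rewrite -diag_Delta_phi //; case: rat_h.
Qed.

End DiagLattice.

End Lattices.

(** * Restriction of lattices to inflations *)

Section Restriction.
Variables (K : fieldType) (n : nat) (C : 'M[int]_n) (d : 'I_n -> nat) (q : K).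
Implicit Types (J : {set 'I_n}) (nu mu : coweight n).

Lemma is_module_restrict J mu (V : loop_module K n) :
  is_module C d q [set: 'I_n]%SET mu V -> is_module C d q J mu V.
Proof.
move=> hV; have inT i : i \in [set: 'I_n]%SET by rewrite finset.in_setT.
split.
- by move=> i r v _; apply: (phi_plus_lt0 hV).
- by move=> i r v _; apply: (phi_minus_gt hV).
- by move=> e i _; apply: (phi_lead_inv hV).
- by move=> e e' i j r s v _ _; apply: (phi_comm hV).
- by move=> e i j r v _ _; apply: (phi_plus_x hV).
- by move=> e i j r v _ _; apply: (phi_minus_x hV).
- have [h hspec hx] := h_x hV; exists h.
    by move=> e i r v _; apply: hspec.
  by move=> e i j r m v _ _; apply: hx.
- by move=> i j r s v _ _; apply: (x_plus_minus hV).
- by move=> e i j r s v _ _; apply: (x_quadratic hV).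
- by move=> e i j p r' r v _ _; apply: (x_serre hV).
Qed.

Lemma ser_submodule_restrict J mu (V1 V2 : loop_module K n)
    (S : (int -> tensor V1 V2) -> Prop) :
  ser_submodule [set: 'I_n]%SET mu S -> ser_submodule J mu S.
Proof.
move=> hS; have inT i : i \in [set: 'I_n]%SET by rewrite finset.in_setT.
split.
- exact: (ser_rational hS).
- exact: (ser_zero hS).
- exact: (ser_add hS).
- exact: (ser_scale hS).
- by move=> e i r f _; apply: (ser_x hS).
- by move=> e i r f _; apply: (ser_phi hS).
- by move=> e i f _; apply: (ser_phi_inv hS).
Qed.

Lemma leadD mu1 mu2 e i : lead (mu1 + mu2) e i = lead mu1 e i + lead mu2 e i :> int.
Proof. by case: e => //=; rewrite /lead ffunE. Qed.

End Restriction.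

Section InflationFamilies.
Variables (K : fieldType) (n : nat) (C : 'M[int]_n) (d : 'I_n -> nat) (q : K).
Hypothesis char0 : forall k, k.+1%:R != 0 :> K.
Implicit Types (i j : 'I_n) (J : {set 'I_n}) (e : bool) (r s : int).

Lemma diag_family_phi J mu (V : loop_module K n) (v : V) i :
  is_module C d q [set: 'I_n]%SET mu V -> sing_gen [set: 'I_n]%SET mu v ->
  diag_family J v (fun e j => phi_x_coef C d q true e i j) (lm_phi V true i).
Proof.
move=> hV hv; have inT k : k \in [set: 'I_n]%SET by rewrite finset.in_setT.
have phi_lt0 r (u : V) : r < 0 -> lm_phi V true i r u = 0.
  by move=> r0; apply: (phi_plus_lt0 hV).
split=> //.
- move=> e j jJ r s M u lt_rM; have [r0|r_ge0] := ltP r 0.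
    rewrite phi_lt0 // big1 // => m _; rewrite phi_lt0 ?linear0 ?scaler0 //; lia.
  case: r r_ge0 lt_rM => // p _ lt_pM; have {}lt_pM : (p < M)%N by lia.
  have := phi_x_comm char0 hV true e p s u (inT i) (inT j).
  rewrite /lead /pm mul1r add0r => ->.
  rewrite (big_ord_widen M (fun m => phi_x_coef C d q true e i j m *:
    lm_x V e j (s + 1 * m%:Z) (lm_phi V true i (0 + 1 * (p - m)%N%:Z) u))) //.
  rewrite big_mkcond; apply: eq_bigr => m _ /=; rewrite !mul1r add0r.
  case: ifP => [|/negbT]; first by rewrite ltnS => le_mp; rewrite subzn.
  by rewrite -leqNgt => lt_pm; rewrite phi_lt0 ?linear0 ?scaler0 //; lia.
- by move=> e j jJ r s u; apply: (phi_comm hV).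
- by move=> r; apply: (sing_phi hv).
Qed.

Hypothesis q0 : q != 0.

Definition inv_coef e i (e' : bool) j (m : nat) : K :=
  if m == 0%N then (q_ d q i ^ (pm e * (pm e' * C i j)))^-1 else 0.

(** The inverse of a leading mode, placed in degree 0, is again a diagonal family, its scalar series
    being a constant; stability under inverses thus reduces to the same argument as for phi_i. *)
Lemma diag_family_inv J mu (V : loop_module K n) (v : V) e i :
  is_module C d q [set: 'I_n]%SET mu V -> sing_gen [set: 'I_n]%SET mu v ->
  exists f, [/\ diag_family J v (inv_coef e i) f,
    cancel (lm_phi V e i (lead mu e i)) (f 0) &
    forall r u, r != 0 -> f r u = 0].
Proof.
move=> hV hv; have inT k : k \in [set: 'I_n]%SET by rewrite finset.in_setT.
have [f' phiK f'K] := linear_inverse (phi_lead_inv hV e (inT i)).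
pose f (r : int) : {linear V -> V} := if r == 0 then f' else (\0%R : {linear V -> V}).
have f_neq0 r u : r != 0 -> f r u = 0 by rewrite /f => /negPf ->.
have phi_inj := can_inj phiK.
exists f; split=> //; split.
- by move=> r u r0; apply: f_neq0; lia.
- move=> e' j jJ r s [|M] u lt_rM.
    by rewrite big_ord0 f_neq0 //; lia.
  rewrite big_ord_recl big1 ?addr0 => [|m _]; last by rewrite /inv_coef scale0r.
  rewrite /inv_coef /=.
  have [->|r0] := eqVneq r 0; last by rewrite !f_neq0 // linear0 scaler0.
  apply: phi_inj; rewrite /f eqxx f'K linearZ /= (phi_lead_x hV) // f'K.
  by rewrite scalerA mulVf ?scale1r // expfz_neq0 // expf_neq0.
- move=> e' j jJ r s u; have [->|r0] := eqVneq r 0.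
    by apply: phi_inj; rewrite /f eqxx f'K (phi_comm hV) // f'K.
  by rewrite !f_neq0 // linear0.
- move=> r; have [->|r0] := eqVneq r 0; last by rewrite f_neq0 //; apply: line0.
  have [c hc] := sing_phi hv e (lead mu e i) (inT i).
  have c0 : c != 0.
    apply: contra (sing_neq0 hv) => /eqP c0; apply/eqP; apply: phi_inj.
    by rewrite hc c0 scale0r linear0.
  exists c^-1; apply: phi_inj.
  by rewrite /f eqxx f'K linearZ /= hc scalerA mulVf // scale1r.
Qed.

End InflationFamilies.

Section InflationLattice.
Variables (K : fieldType) (n : nat) (C : 'M[int]_n) (d : 'I_n -> nat) (q : K).
Hypotheses (char0 : forall k, k.+1%:R != 0 :> K) (q0 : q != 0).
Variable J : {set 'I_n}.
Implicit Types (i j : 'I_n) (e : bool) (r s : int) (V : loop_module K n).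
Local Notation I := [set: 'I_n]%SET.

Definition x_vanish V : Prop :=
  forall e i r (v : V), i \notin J -> lm_x V e i r v = 0.

(** The commutator of x_i^+ and x_i^- is zero on both sides of its relation. *)
Lemma phi_plus_minus mu V i r (v : V) : is_module C d q I mu V -> x_vanish V ->
  i \notin J -> lm_phi V false i r v = lm_phi V true i r v.
Proof.
move=> hV V0 iJ; have inT : i \in I by rewrite finset.in_setT.
have := x_plus_minus hV r 0 v inT inT.
rewrite !V0 // subr0 scaler0 eqxx addr0 => /esym/eqP.
by rewrite subr_eq0 => /eqP.
Qed.

Lemma Delta_x_vanish V1 V2 e i r (f : int -> tensor V1 V2) :
  x_vanish V1 -> x_vanish V2 -> i \notin J -> Delta_x e i r f = fun=> 0.
Proof.
move=> V10 V20 iJ; apply: funext => k; case: e.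
  rewrite Delta_x_plusE /conv !fsum0 ?addr0 // => t.
    by apply: tens0r => w; apply: V20.
  by apply: tens0l => v; apply: V10.
rewrite Delta_x_minusE /conv !fsum0 ?addr0 // => t.
  by apply: tens0l => v; apply: V10.
by apply: tens0r => w; apply: V20.
Qed.

(** The g_J-submodule generated by v is stable under g: outside J the x_i vanish, and phi_i and the
    inverse leading modes are diagonal families. *)
Lemma sing_gen_restrict mu V (v : V) :
  is_module C d q I mu V -> x_vanish V -> sing_gen I mu v -> sing_gen J mu v.
Proof.
move=> hV V0 hv; have inT k : k \in I by rewrite finset.in_setT.
split; first exact: (sing_neq0 hv).
- by move=> j r _; apply: (sing_x hv).
- by move=> e j r _; apply: (sing_phi hv).
move=> S hS Sv w; pose X u := forall S : V -> Prop, submodule J mu S -> S v -> S u.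
suff : X w by apply.
apply: (sing_all hv) => //; split.
- by move=> S' hS' _; apply: (sub_zero hS').
- by move=> a u u' Xu Xu' S' hS' Sv'; apply: (sub_lin hS'); [apply: Xu | apply: Xu'].
- move=> e i r u _ Xu S' hS' Sv'; have [iJ|iJ] := boolP (i \in J).
    by apply: (sub_x hS') => //; apply: Xu.
  by rewrite V0 //; apply: (sub_zero hS').
- move=> e i r u _ Xu S' hS' Sv'; have [iJ|iJ] := boolP (i \in J).
    by apply: (sub_phi hS') => //; apply: Xu.
  suff : S' (lm_phi V true i r u) by case: e => //; rewrite (phi_plus_minus _ _ hV).
  exact: (diag_submodule (diag_family_phi char0 J i hV hv) _ Xu).
move=> e i u _ Xu S' hS' Sv'; have [iJ|iJ] := boolP (i \in J).
  by apply: (sub_phi_inv hS' (e := e) iJ); apply: Xu.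
have [f [hf phiK _]] := diag_family_inv q0 J e i hV hv.
by rewrite -[u]phiK; apply: (diag_submodule hf _ Xu).
Qed.

Lemma fusion_lattice_restrict mu1 mu2 V1 V2 (v1 : V1) (v2 : V2) f :
  is_module C d q I mu1 V1 -> is_module C d q I mu2 V2 ->
  x_vanish V1 -> x_vanish V2 -> sing_gen I mu1 v1 -> sing_gen I mu2 v2 ->
  (exists S, ser_submodule I (mu1 + mu2) S /\ S (cst_ser (pure v1 v2))) ->
  fusion_lattice I (mu1 + mu2) v1 v2 f <-> fusion_lattice J (mu1 + mu2) v1 v2 f.
Proof.
move=> hV1 hV2 V10 V20 hv1 hv2 exS; split; last first.
  by move=> Xf S hS; apply: Xf; apply: ser_submodule_restrict.
set X := fusion_lattice J _ _ _.
have hX : ser_submodule J (mu1 + mu2) X.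
  apply: fusion_lattice_submodule; have [S [hS Sv]] := exS.
  by exists S; split=> //; apply: ser_submodule_restrict.
have hV1J := is_module_restrict J hV1; have hV2J := is_module_restrict J hV2.
move/(_ X); apply; last by [].
split; [exact: (ser_rational hX)|exact: (ser_zero hX)|exact: (ser_add hX)|
        exact: (ser_scale hX)| | |].
- move=> e i r h _ Xh; have [iJ|iJ] := boolP (i \in J); first exact: (ser_x hX).
  by rewrite (Delta_x_vanish _ _ _ V10 V20) //; apply: (ser_zero hX).
- move=> e i r h _ Xh; have [iJ|iJ] := boolP (i \in J); first exact: (ser_phi hX).
  have -> : Delta_phi e i r h = Delta_phi true i r h.
    case: e => //; apply: funext => k; apply: eq_fsum => t.
    by apply: eq_tens => u;
      [apply: (phi_plus_minus _ _ hV1) | apply: (phi_plus_minus _ _ hV2)].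
  exact: (diag_lattice hV1J hV2J (diag_family_phi char0 J i hV1 hv1)
    (diag_family_phi char0 J i hV2 hv2)).
move=> e i h _ rat_h; have [iJ|iJ] := boolP (i \in J); first exact: (ser_phi_inv hX).
have [f1 [hf1 phi1K f1_neq0]] := diag_family_inv q0 J e i hV1 hv1.
have [f2 [hf2 phi2K f2_neq0]] := diag_family_inv q0 J e i hV2 hv2.
(* The bounds on the two factors leave only t = [lead mu2 e i] in the leading mode of the coproduct.
   It is thus the tensor of the two leading modes times a power of u, undone by [f1], [f2] in degree
   0 and a shift. *)
move/(diag_lattice hV1J hV2J hf1 hf2 0 hX)/(ser_shift hX (- lead mu2 e i)).
congr X; apply: funext => k; rewrite /conv (fsum1 (c := 0)) => [|t t0]; last first.
  by apply: tens0r => w; apply: f2_neq0.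
rewrite Delta_phiE /conv (fsum1 (c := lead mu2 e i)) => [|t t_neq].
  rewrite leadD addrK tens_comp subr0 opprK (subr0 (k + _)) addrK.
  by rewrite (eq_tens (f' := id) (g' := id)) ?tens_id.
have iI : i \in I by rewrite finset.in_setT.
have [lt_t|ge_t] := ltP (pm e * (t - lead mu2 e i)) 0.
  by apply: tens0r => w; apply: (phi_vanish hV2).
apply: tens0l => w; apply: (phi_vanish hV1) => //.
by rewrite leadD; move: ge_t t_neq; case: (e); rewrite /pm; lia.
Qed.

End InflationLattice.

(** * Transport along isomorphisms and the fusion product *)

Section LinearSeries.
Variables (K : fieldType) (T U : lmodType K) (L : T -> U).
Hypothesis lL : linear L.
Implicit Types (f g : int -> T).

Lemma laurent_linear f : laurent f -> laurent (L \o f).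
Proof. by case=> N fN; exists N => k /fN /= ->; apply: linear_fun0. Qed.

Lemma rational_linear f : rational_ser f -> rational_ser (L \o f).
Proof.
case=> hf [Q Q0 [M fM]]; split; first exact: laurent_linear.
by exists Q => //; exists M => k /fM e; rewrite pmul_ser_linear // e linear_fun0.
Qed.

Lemma frac_mul_linear F f g :
  frac_mul_ser F f g -> frac_mul_ser F (L \o f) (L \o g).
Proof.
case=> P [Q [Q0 eF e]]; exists P, Q; split=> //.
by apply: funext => k; rewrite !pmul_ser_linear // e.
Qed.

End LinearSeries.

Section Transport.
Variables (K : fieldType) (n : nat) (C : 'M[int]_n) (d : 'I_n -> nat) (q : K).
Variables (J : {set 'I_n}).
Implicit Types (i j : 'I_n) (e : bool) (r s : int).

Record loop_morphism (V W : loop_module K n) (theta : V -> W) : Prop := {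
  lmor_x : forall e i r v, i \in J -> theta (lm_x V e i r v) = lm_x W e i r (theta v);
  lmor_phi : forall e i r v, i \in J ->
    theta (lm_phi V e i r v) = lm_phi W e i r (theta v)
}.

Lemma loop_morphism_inv (V W : loop_module K n) (theta : V -> W) (theta' : W -> V) :
  cancel theta theta' -> cancel theta' theta ->
  loop_morphism theta -> loop_morphism theta'.
Proof.
move=> thK thK' [hx hphi].
by split=> e i r v iJ; apply: (can_inj thK); rewrite ?hx ?hphi // !thK'.
Qed.

Lemma sing_gen_transport (nu nu' : coweight n) (V W : loop_module K n)
    (theta : {linear V -> W}) v :
  bijective theta -> loop_morphism theta -> {in J, nu =1 nu'} ->
  sing_gen J nu v -> sing_gen J nu' (theta v).
Proof.
move=> [theta' thK thK'] hth enu hv; split.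
- apply: contra (sing_neq0 hv) => /eqP e; apply/eqP.
  by apply: (can_inj thK); rewrite e linear0.
- by move=> j r jJ; rewrite -(lmor_x hth) // (sing_x hv) // linear0.
- move=> e j r jJ; have [c hc] := sing_phi hv e r jJ.
  by exists c; rewrite -(lmor_phi hth) // hc linearZ.
move=> S hS Sv w; rewrite -[w]thK'.
apply: (sing_all hv (S := fun u => S (theta u))) => //; split.
- by rewrite linear0; apply: (sub_zero hS).
- by move=> a u u' Su Su'; rewrite linearP; apply: (sub_lin hS).
- by move=> e i r u iJ Su; rewrite (lmor_x hth) //; apply: (sub_x hS).
- by move=> e i r u iJ Su; rewrite (lmor_phi hth) //; apply: (sub_phi hS).
move=> e i u iJ; rewrite (lmor_phi hth) // => Su.
apply: (sub_phi_inv hS (e := e) iJ); move: Su.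
by rewrite /lead enu.
Qed.

Lemma conv_transport (V1 V2 W1 W2 : lmodType K)
    (a : int -> {linear V1 -> V1}) (b : int -> {linear V2 -> V2})
    (a' : int -> {linear W1 -> W1}) (b' : int -> {linear W2 -> W2})
    (th1 : {linear V1 -> W1}) (th2 : {linear V2 -> W2}) r f k :
  (forall t v, th1 (a t v) = a' t (th1 v)) ->
  (forall t v, th2 (b t v) = b' t (th2 v)) ->
  lower_bounded a b -> laurent f ->
  tens th1 th2 (conv a b r f k) = conv a' b' r (tens th1 th2 \o f) k.
Proof.
move=> h1 h2 ab_lb hf; rewrite (fsum_linear (tens_linear _ _)); last exact: conv_finsupp.
apply: eq_fsum => t /=; rewrite !tens_comp; apply: eq_tens => u /=; first exact: h1.
exact: h2.
Qed.

Lemma dirac_transport (V W : lmodType K) (th : {linear V -> W}) t v :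
  th (dirac V t v) = dirac W t (th v).
Proof. by rewrite /dirac; case: ifP => //= _; rewrite linear0. Qed.

Section TwoFactors.
Variables (V1 V2 W1 W2 : loop_module K n) (nu1 nu2 nu nu' : coweight n).
Hypotheses (hV1 : is_module C d q J nu1 V1) (hV2 : is_module C d q J nu2 V2).
Hypothesis enu : {in J, nu =1 nu'}.
Variables (th1 : {linear V1 -> W1}) (th2 : {linear V2 -> W2}).
Hypotheses (hth1 : loop_morphism th1) (hth2 : loop_morphism th2).
Let Th := tens th1 th2.

Lemma Delta_phi_transport e i r f : i \in J -> laurent f ->
  Th \o Delta_phi e i r f = Delta_phi e i r (Th \o f).
Proof.
move=> iJ hf; apply: funext => k /=.
apply: conv_transport => // [t v|t v|]; [exact: (lmor_phi hth1)|exact: (lmor_phi hth2)|].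
exact: (phi_phi_bounded hV1 hV2).
Qed.

Lemma Delta_x_transport e i r f : i \in J -> laurent f ->
  Th \o Delta_x e i r f = Delta_x e i r (Th \o f).
Proof.
move=> iJ hf; apply: funext => k /=.
have h1 := fun t v => lmor_x hth1 e t v iJ; have h2 := fun t v => lmor_x hth2 e t v iJ.
case: e h1 h2 => h1 h2.
  rewrite !Delta_x_plusE /Th /= (linear_funD (tens_linear _ _)); congr (_ + _).
    apply: conv_transport => // [t v|]; first exact: dirac_transport.
    exact: x_dirac_bounded.
  apply: conv_transport => // [t v|]; first exact: (lmor_phi hth1).
  exact: (phi_x_bounded _ hV1).
rewrite !Delta_x_minusE /Th /= (linear_funD (tens_linear _ _)); congr (_ + _).
  apply: conv_transport => // [t v|]; first exact: dirac_transport.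
  exact: dirac_x_bounded.
apply: conv_transport => // [t v|]; first exact: (lmor_phi hth2).
exact: (x_phi_bounded _ hV2).
Qed.

(** Any stable lattice of the target pulls back to one of the source. The coweights need only agree
    on J, as mu and its restriction nu do. *)
Lemma fusion_lattice_transport v1 v2 f : bijective th1 -> bijective th2 ->
  fusion_lattice J nu v1 v2 f ->
  fusion_lattice J nu' (th1 v1) (th2 v2) (Th \o f).
Proof.
move=> bij1 bij2 Xf S hS Sv.
have [th1' th1K _] := linear_inverse bij1; have [th2' th2K _] := linear_inverse bij2.
have lTh : linear Th by apply: tens_linear.
(* Bijectivity is used here: rationality is recovered by applying the inverse isomorphisms. *)
have rat_f h : S (Th \o h) -> rational_ser h.
  move=> /(ser_rational hS)/(rational_linear (tens_linear th1' th2')).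
  congr rational_ser; apply: funext => k /=; rewrite tens_comp.
  by rewrite (eq_tens (f' := id) (g' := id)) ?tens_id.
have laur_f h : S (Th \o h) -> laurent h by move=> /rat_f[].
apply: (Xf (fun h => S (Th \o h))); last first.
  move: Sv; congr S; apply: funext => k /=; rewrite /cst_ser.
  by case: ifP => _; rewrite ?(linear_fun0 lTh) // /Th tens_pure.
split.
- exact: rat_f.
- rewrite (_ : _ \o _ = fun=> 0); first exact: (ser_zero hS).
  by apply: funext => k /=; apply: linear_fun0.
- move=> h h' Sh Sh'; rewrite (_ : _ \o _ = fun k => (Th \o h) k + (Th \o h') k).
    exact: (ser_add hS).
  by apply: funext => k /=; apply: linear_funD.
- move=> F h h' hF Sh hh' hFhh'; apply: (ser_scale hS hF Sh).
    exact: laurent_linear.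
  exact: frac_mul_linear.
- move=> e i r h iJ Sh; rewrite Delta_x_transport //; last exact: laur_f.
  exact: (ser_x hS).
- move=> e i r h iJ Sh; rewrite Delta_phi_transport //; last exact: laur_f.
  exact: (ser_phi hS).
move=> e i h iJ rat_h; rewrite Delta_phi_transport //; last by case: rat_h.
rewrite (_ : lead nu e i = lead nu' e i); last by rewrite /lead enu.
by apply: (ser_phi_inv hS iJ); apply: rational_linear.
Qed.

End TwoFactors.

Lemma fusion_lattice_scale (V1 V2 : loop_module K n) nu (v1 : V1) (v2 : V2) a1 a2 f :
  a1 != 0 -> a2 != 0 -> fusion_lattice J nu (a1 *: v1) (a2 *: v2) f ->
  fusion_lattice J nu v1 v2 f.
Proof.
move=> a10 a20 Xf S hS Sv; apply: Xf => //.
have := ser_scalar hS (a1 * a2) Sv; congr S; apply: funext => k.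
by rewrite /cst_ser; case: ifP => _; rewrite ?scaler0 // pureZl pureZr scalerA.
Qed.

(* Without any such S, the lattice would consist of all functions, on which    *)
(* u - 1 is surjective, so that the quotient would vanish.                     *)
Lemma fusion_quotient_lattice (V1 V2 V : loop_module K n) nu (v1 : V1) (v2 : V2) (v : V) :
  fusion_quotient J nu v1 v2 V -> v != 0 ->
  exists S, ser_submodule J nu S /\ S (cst_ser (pure v1 v2)).
Proof.
move=> [pi [_ pi_surj pi_ker _ _]] v0; have [//|noS] := EM (exists S,
  ser_submodule J nu S /\ S (cst_ser (pure v1 v2))).
have Xall f : fusion_lattice J nu v1 v2 f.
  by move=> S hS Sv; case: noS; exists S.
have [f _ ef] := pi_surj v; case/eqP: v0; rewrite -ef.
by apply/(pi_ker f (Xall f)); have [g eg] := pmul_XsubC1_surj f; exists g.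
Qed.

End Transport.

(** * Compatibility of the fusion product with inflation *)

Section Corollary.
Variables (K : fieldType) (n : nat) (C : 'M[int]_n) (d : 'I_n -> nat) (q : K).
Hypotheses (char0 : forall k, k.+1%:R != 0 :> K).
Hypotheses (hC : simple_cartan C d) (q0 : q != 0).
Hypothesis q_not_root : forall k : nat, (0 < k)%N -> q ^+ k != 1.
Variable J : {set 'I_n}.
Implicit Types (i j : 'I_n) (e : bool) (r s : int) (V W : loop_module K n).
Local Notation I := [set: 'I_n]%SET.

Lemma res_coweight_in nu mu : res_coweight J mu = nu -> {in J, mu =1 nu}.
Proof. by move=> <- i iJ; rewrite ffunE iJ. Qed.

Lemma res_coweightD mu1 mu2 :
  res_coweight J (mu1 + mu2) = res_coweight J mu1 + res_coweight J mu2.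
Proof. by apply/ffunP => i; rewrite !ffunE; case: ifP; rewrite ?addr0. Qed.

Lemma is_fusion_inflation nu1 nu2 mu1 mu2 W1 W2 V1 V2 W V :
  is_inflation C d q J nu1 mu1 W1 V1 -> is_inflation C d q J nu2 mu2 W2 V2 ->
  is_fusion C d q J nu1 nu2 W1 W2 W -> is_fusion C d q I mu1 mu2 V1 V2 V ->
  is_inflation C d q J (nu1 + nu2) (mu1 + mu2) W V.
Proof.
move=> [OW1 res1 OV1 [th1 [bij1 thx1 thphi1]] V10].
move=> [OW2 res2 OV2 [th2 [bij2 thx2 thphi2]] V20].
move=> [_ _ [OW [w hw]] [w1 [w2 [hw1 hw2 quoW]]]].
move=> [_ _ [OV [v hv]] [v1 [v2 [hv1 hv2 quoV]]]].
have mW1 := O_module OW1; have mW2 := O_module OW2.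
have mV1 := O_module OV1; have mV2 := O_module OV2.
have mV1J := is_module_restrict J mV1; have mV2J := is_module_restrict J mV2.
have lth1 : loop_morphism J th1 by []. have lth2 : loop_morphism J th2 by [].
have sv1 := hl_sing_gen mV1 hv1; have sv2 := hl_sing_gen mV2 hv2.
have [a1 a10 ev1] : exists2 a, a != 0 & th1 v1 = a *: w1.
  apply: (sing_gen_unique char0 hC q0 q_not_root mW1 (hl_sing_gen mW1 hw1)).
  apply: (sing_gen_transport bij1 lth1 (res_coweight_in res1)).
  exact: (sing_gen_restrict char0 q0 mV1 V10 sv1).
have [a2 a20 ev2] : exists2 a, a != 0 & th2 v2 = a *: w2.
  apply: (sing_gen_unique char0 hC q0 q_not_root mW2 (hl_sing_gen mW2 hw2)).
  apply: (sing_gen_transport bij2 lth2 (res_coweight_in res2)).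
  exact: (sing_gen_restrict char0 q0 mV2 V20 sv2).
have res12 : res_coweight J (mu1 + mu2) = nu1 + nu2 by rewrite res_coweightD res1 res2.
have exV := fusion_quotient_lattice quoV (hl_neq0 hv).
have exW := fusion_quotient_lattice quoW (hl_neq0 hw).
have hXV := fusion_lattice_submodule exV; have hXW := fusion_lattice_submodule exW.
have [th1' th1K th1K'] := linear_inverse bij1.
have [th2' th2K th2K'] := linear_inverse bij2.
pose Th := tens th1 th2; pose Th' := tens th1' th2'.
have ThK : cancel Th Th'.
  by move=> x; rewrite /Th /Th' tens_comp (eq_tens (f' := id) (g' := id)) ?tens_id.
have ThK' : cancel Th' Th.
  by move=> x; rewrite /Th /Th' tens_comp (eq_tens (f' := id) (g' := id)) ?tens_id.
have lTh : linear Th by apply: tens_linear.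
set XV := fusion_lattice I (mu1 + mu2) v1 v2 in hXV *.
set XW := fusion_lattice J (nu1 + nu2) w1 w2 in hXW *.
have XVJ f : XV f <-> fusion_lattice J (mu1 + mu2) v1 v2 f.
  exact: (fusion_lattice_restrict char0 q0 f mV1 mV2).
have XVW f : XV f -> XW (Th \o f).
  move=> /XVJ /(fusion_lattice_transport mV1J mV2J (res_coweight_in res12)
    lth1 lth2 bij1 bij2).
  by rewrite ev1 ev2; apply: fusion_lattice_scale.
have XWV h : XW h -> XV (Th' \o h).
  move=> Xh; apply/XVJ; apply: (@fusion_lattice_scale _ _ _ _ _ _ _ _ a1^-1 a2^-1);
    rewrite ?invr_eq0 //.
  have -> : a1^-1 *: v1 = th1' w1.
    by apply: (can_inj th1K); rewrite th1K' linearZ /= ev1 scalerA mulVf // scale1r.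
  have -> : a2^-1 *: v2 = th2' w2.
    by apply: (can_inj th2K); rewrite th2K' linearZ /= ev2 scalerA mulVf // scale1r.
  apply: (fusion_lattice_transport (nu := nu1 + nu2) mW1 mW2) => //.
  - by move=> i iJ; rewrite (res_coweight_in res12).
  - exact: (loop_morphism_inv th1K th1K' lth1).
  - exact: (loop_morphism_inv th2K th2K' lth2).
  - by exists th1.
  - by exists th2.
have [piV [piV_lin piV_surj piV_ker piV_x piV_phi]] := quoV.
have [piW [piW_lin piW_surj piW_ker piW_x piW_phi]] := quoW.
rewrite -/XV in piV_lin piV_surj piV_ker piV_x piV_phi.
rewrite -/XW in piW_lin piW_surj piW_ker piW_x piW_phi.
have Th_pmul Q f : Th \o pmul_ser Q f = pmul_ser Q (Th \o f).
  by apply: funext => k; rewrite pmul_ser_linear.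
have Th_lin a f g : Th \o (fun k => a *: f k + g k) = fun k => a *: Th (f k) + Th (g k).
  by apply: funext => k; apply: lTh.
(* Since [Th] matches the lattices and commutes with u - 1, it matches the submodules (u - 1) X, and
   so descends to an injective map of quotients. *)
have ker_iff f : XV f -> (piV f = 0 <-> piW (Th \o f) = 0).
  move=> Xf; split=> [/(piV_ker f Xf)[g Xg ef]|/(piW_ker _ (XVW f Xf))[g Xg eg]].
    apply/(piW_ker _ (XVW f Xf)); exists (Th \o g); first exact: XVW.
    by rewrite ef Th_pmul.
  apply/(piV_ker f Xf); exists (Th' \o g); first exact: XWV.
  apply: funext => k; apply: (can_inj ThK).
  rewrite -[LHS]/((Th \o f) k) eg -[RHS]/((Th \o _) k) Th_pmul.
  by congr pmul_ser; apply: funext => k' /=; rewrite ThK'.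
(* A choice of lifts to the lattice defines [theta]; [thetaE] shows that the result does not depend
   on the lift. *)
have [sV hsV] := choice (fun u => let: ex_intro2 f Xf ef := piV_surj u in
  ex_intro (fun f => XV f /\ piV f = u) f (conj Xf ef)).
pose theta u := piW (Th \o sV u).
have thetaE f : XV f -> theta (piV f) = piW (Th \o f).
  move=> Xf; have [Xs es] := hsV (piV f).
  have Xd : XV (fun k => -1 *: f k + sV (piV f) k).
    by apply: (ser_add hXV) => //; apply: (ser_scalar hXV).
  have : piV (fun k => -1 *: f k + sV (piV f) k) = 0.
    by rewrite piV_lin // es scaleN1r addNr.
  move/(ker_iff _ Xd); rewrite Th_lin piW_lin; [|exact: XVW|exact: XVW].
  by rewrite scaleN1r addrC => /eqP; rewrite subr_eq0 => /eqP.
have theta_lin : linear theta.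
  move=> a u u'; have [Xu eu] := hsV u; have [Xu' eu'] := hsV u'.
  have Xc : XV (fun k => a *: sV u k + sV u' k).
    by apply: (ser_add hXV) => //; apply: (ser_scalar hXV).
  rewrite -{1}eu -{1}eu' -piV_lin // thetaE // Th_lin piW_lin //; exact: XVW.
pose Theta : {linear V -> W} :=
  HB.pack theta (GRing.isLinear.Build K V W *:%R theta theta_lin).
have inT i : i \in I by rewrite finset.in_setT.
have theta_inj : injective theta.
  move=> u u' e; apply/eqP; rewrite -subr_eq0 addrC -scaleN1r; apply/eqP.
  have [Xd ed] := hsV (-1 *: u' + u); rewrite -ed; apply/(ker_iff _ Xd).
  by rewrite -/(theta _) theta_lin e scaleN1r addNr.
have theta_surj y : exists u, theta u = y.
  have [h Xh <-] := piW_surj y; exists (piV (Th' \o h)).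
  rewrite thetaE; last exact: XWV.
  by congr piW; apply: funext => k /=; rewrite ThK'.
have theta_bij : bijective theta.
  have [tinv htinv] := choice theta_surj.
  by exists tinv => // u; apply: theta_inj; rewrite htinv.
split=> //.
- exists Theta; split=> // e i r u iJ; rewrite -[LHS]/(theta _) -[Theta u]/(theta u);
    have [Xu eu] := hsV u; rewrite -{1}eu.
    rewrite -piV_x // thetaE; last exact: (ser_x hXV).
    rewrite (Delta_x_transport mV1J mV2J lth1 lth2) //; last exact: (ser_laurent hXV).
    by rewrite piW_x //; apply: XVW.
  rewrite -piV_phi // thetaE; last exact: (ser_phi hXV).
  rewrite (Delta_phi_transport mV1J mV2J lth1 lth2) //; last exact: (ser_laurent hXV).
  by rewrite piW_phi //; apply: XVW.
(* For i outside J the coproduct of x_i already kills every series, hence x_i is zero on the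
   quotient. *)
move=> e i r u iJ; have [Xu <-] := hsV u; rewrite -piV_x //.
rewrite (Delta_x_vanish _ _ _ V10 V20 iJ).
have X0 := ser_zero hXV; apply/(piV_ker _ X0); exists (fun=> 0) => //.
by apply: funext => k; rewrite pmul_XsubC1 subrr.
Qed.

Lemma is_iter_fusion_inflation m (nu mu : nat -> coweight n)
    (W V : nat -> loop_module K n) Wf Vf :
  (forall k, (k < m)%N -> is_inflation C d q J (nu k) (mu k) (W k) (V k)) ->
  is_iter_fusion C d q J nu W m Wf -> is_iter_fusion C d q I mu V m Vf ->
  is_inflation C d q J (\sum_(k < m) nu k) (\sum_(k < m) mu k) Wf Vf.
Proof.
move=> hV hW; elim: hW hV Vf => {m Wf} [|m X Y hX IHX hXY] hV Vf hVf.
  rewrite !big_ord1; inversion hVf as [|m' X' Y' hX' _]; first exact: hV.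
  by inversion hX'.
(* No product of zero factors exists, so the two bracketings are built by the same steps. *)
inversion hVf as [e1 e2|m' X' Y' hX' hXY' e1 e2]; first by subst m; inversion hX.
rewrite !big_ord_recr /=; apply: (is_fusion_inflation _ _ hXY hXY'); last exact: hV.
by apply: IHX => // k lt_k; apply: hV; apply: ltnW.
Qed.

End Corollary.

Theorem corollary3p25 (R : realType) (n : nat) (C : 'M[int]_n) (d : 'I_n -> nat)
  (hC : simple_cartan C d)
  (q : R[i]) (hq0 : q != 0) (hq : forall k : nat, (0 < k)%N -> q ^+ k != 1)
  (J : {set 'I_n}) (m : nat) (nu mu : nat -> coweight n)
  (W V : nat -> loop_module R[i] n)
  (hnu : forall k, (k < m)%N -> in_coweight J (nu k))
  (hW : forall k, (k < m)%N -> hl_module C d q J (nu k) (W k))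
  (hV : forall k, (k < m)%N -> is_inflation C d q J (nu k) (mu k) (W k) (V k))
  (Wf Vf : loop_module R[i] n)
  (hWf : is_iter_fusion C d q J nu W m Wf)
  (hVf : is_iter_fusion C d q [set: 'I_n] mu V m Vf) :
  is_inflation C d q J (\sum_(k < m) nu k) (\sum_(k < m) mu k) Wf Vf.
Proof.
have char0 k : k.+1%:R != 0 :> R[i] by rewrite pnatr_eq0.
exact: (is_iter_fusion_inflation char0 hC hq0 hq hV hWf hVf).
Qed.
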